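(* Let $[\mu]\in S_n$ be a critical point of $F_n:S_n\to\mathbb{R}$ with $\mathrm{M}_\mu=c_\mu I+D_\mu$ of type $(0<k_2<\cdots<k_r;d_1,d_2,\dots,d_r)$, let $\mathfrak{l}=(\mathbb{C}^n,\mu)$, and consider $\mathfrak{l}=\mathfrak{l}_0\oplus\mathfrak{l}_+$, the direct sum of the eigenspaces of $D_\mu$ with eigenvalues equal to zero and larger than zero, respectively. Then the following statements hold: (i) $(L_A^\mu)^*,(R_A^\mu)^*\in\mathrm{Der}(\mu)$ for any $A\in\mathfrak{l}_0$. (ii) $\mathfrak{l}_0$ is a reductive Lie subalgebra, i.e., a direct sum of the center and a semisimple ideal. (iii) $L_Z^\mu,R_Z^\mu$ are normal operators for any $Z\in\mathfrak{z}(\mathfrak{l}_0)$, where $\mathfrak{z}(\mathfrak{l}_0)$ denotes the center of $\mathfrak{l}_0$. (iv) $\mathfrak{l}_+$ is the nilradical of $\mu$, and it corresponds to a critical point of type $(k_2<\cdots<k_r;d_2,\dots,d_r)$ for the functional $F_m:S_m\to\mathbb{R}$, where $m=\dim\mathfrak{l}_+$.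
   Context: Let $V_n=\otimes^2(\mathbb{C}^n)^*\otimes\mathbb{C}^n$ be the space of all bilinear maps $\mu:\mathbb{C}^n\times\mathbb{C}^n\to\mathbb{C}^n$. $\mathrm{GL}(n)$ acts on $V_n$ by $g.\mu(X,Y)=g\mu(g^{-1}X,g^{-1}Y)$, and $\mathrm{Der}(\mu)$ is the derivation algebra of $\mu$. Fix a Hermitian inner product on $\mathbb{C}^n$; it induces the Hermitian inner product $\langle\mu,\lambda\rangle=\sum_{i,j,k}\langle\mu(X_i,X_j),X_k\rangle\overline{\langle\lambda(X_i,X_j),X_k\rangle}$ on $V_n$, where $\{X_i\}$ is any orthonormal basis of $\mathbb{C}^n$. On $\mathfrak{gl}(n)$ put $(A,B)=\operatorname{tr}AB^*$, where $^*$ is the conjugate transpose with respect to the fixed inner product; $\mathrm{i}\mathfrak{u}(n)$ is the space of Hermitian operators. The moment map $m:\mathbb{P}V_n\to\mathrm{i}\mathfrak{u}(n)$ is defined by $(m([\mu]),A)=(\mathrm{d}\rho_\mu)_eA/\|\mu\|^2$ for $A\in\mathrm{i}\mathfrak{u}(n)$, where $\rho_\mu(g)=\langle g.\mu,g.\mu\rangle$, and $F_n([\mu])=\|m([\mu])\|^2$. With $L^\mu_X(Y)=\mu(X,Y)$, $R^\mu_X(Y)=\mu(Y,X)$, set $\mathrm{M}_\mu=2\sum_iL^\mu_{X_i}(L^\mu_{X_i})^*-2\sum_i(L^\mu_{X_i})^*L^\mu_{X_i}-2\sum_i(R^\mu_{X_i})^*R^\mu_{X_i}$; one has $m([\mu])=\mathrm{M}_\mu/\|\mu\|^2$.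 It is known that $[\mu]$ is a critical point of $F_n:\mathbb{P}V_n\to\mathbb{R}$ iff $\mathrm{M}_\mu=c_\mu I+D_\mu$ with $c_\mu\in\mathbb{R}$, $D_\mu\in\mathrm{Der}(\mu)$. Type: for a critical point $[\mu]$ with $\mathrm{M}_\mu=c_\mu I+D_\mu$ there is a constant $c>0$ such that the eigenvalues of $cD_\mu$ are integers $k_1<\cdots<k_r$ prime to each other, with multiplicities $d_1,\dots,d_r$; the data $(k_1<\cdots<k_r;d_1,\dots,d_r)$ is the type of $[\mu]$. A symmetric Leibniz algebra is an algebra satisfying $x(yz)=(xy)z+y(xz)$ and $(xy)z=(xz)y+x(yz)$ for all $x,y,z$. $S_n\subset\mathbb{P}V_n$ is the projectivization of the algebraic variety of all symmetric Leibniz algebra structures on $\mathbb{C}^n$. The critical points of $F_n:S_n\to\mathbb{R}$ are precisely the critical points of $F_n:\mathbb{P}V_n\to\mathbb{R}$ that lie in $S_n$. Ideals are two-sided; an algebra is nilpotent if there is $k$ such that every product of $k$ elements, however associated, is zero; the nilradical is the unique maximal nilpotent ideal. In (iv), $\mathfrak{l}_+$ carries the restricted multiplication and the restricted inner product, and is identified isometrically with $\mathbb{C}^m$.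
   Formalization: In (iv), that l_+ gives a critical point of F_m on S_m is asserted only when the restricted multiplication on l_+ is nonzero (otherwise, e.g. sl_2 acting on C^2, it defines no point of P V_m); the decomposition M = cI + D with the stated type is proved in every case. *)

(* Defs.v *)
From HB Require Import structures.
From mathcomp Require Import all_boot all_order all_algebra.
From mathcomp Require Import sesquilinear.
From mathcomp Require Import all_classical all_reals all_analysis.
From mathcomp Require Import complex.

Set Implicit Arguments.
Unset Strict Implicit.
Unset Printing Implicit Defensive.

Import Order.TTheory GRing.Theory Num.Theory.
Import passmx numFieldNormedType.Exports.
Local Open Scope ring_scope.

Section BilinearMaps.
Variables (R : realType) (V : vectType R[i]).

(* Currying makes the space of bilinear maps V x V -> V a vectType; [mu x] is
   the left multiplication L_x. *)
Definition bilin := 'Hom(V, 'End(V)).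

Definition rmult (mu : bilin) (x : V) : 'End(V) := linfun (fun y => mu y x).

Definition act (g : 'End(V)) (mu : bilin) : bilin :=
  linfun (fun x => (g \o mu ((g^-1)%VF x) \o g^-1)%VF).

Definition is_der (mu : bilin) (D : 'End(V)) : Prop :=
  forall x y, D (mu x y) = mu (D x) y + mu x (D y).

Definition sym_leibniz (mu : bilin) : Prop :=
  (forall x y z, mu x (mu y z) = mu (mu x y) z + mu y (mu x z)) /\
  (forall x y z, mu (mu x y) z = mu (mu x z) y + mu x (mu y z)).

Definition ideal (mu : bilin) (U I : {vspace V}) : Prop :=
  (I <= U)%VS /\ forall x y, x \in U -> y \in I -> mu x y \in I /\ mu y x \in I.

Definition lie_subalgebra (mu : bilin) (U : {vspace V}) : Prop :=
  [/\ forall x y, x \in U -> y \in U -> mu x y \in U,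
      forall x, x \in U -> mu x x = 0
    & forall x y z, x \in U -> y \in U -> z \in U ->
        mu x (mu y z) + mu y (mu z x) + mu z (mu x y) = 0].

Definition central (mu : bilin) (U : {vspace V}) (z : V) : Prop :=
  z \in U /\ forall y, y \in U -> mu z y = 0 /\ mu y z = 0.

Definition prod_space (mu : bilin) (U W : {vspace V}) : {vspace V} :=
  <<[seq mu x y | x <- vbasis U, y <- vbasis W]>>%VS.

Definition solvable (mu : bilin) (U : {vspace V}) : Prop :=
  exists k, iter k (fun W => prod_space mu W W) U = 0%VS.

(* Vanishing radical; in particular the zero algebra is semisimple. *)
Definition semisimple (mu : bilin) (U : {vspace V}) : Prop :=
  forall I, ideal mu U I -> solvable mu I -> I = 0%VS.

Definition reductive (mu : bilin) (U : {vspace V}) : Prop :=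
  exists Z S : {vspace V},
    [/\ forall z, z \in Z <-> central mu U z,
        ideal mu U S, semisimple mu S,
        (Z + S)%VS = U & (Z :&: S)%VS = 0%VS].

(* [nprod mu U k x]: x is a product of k elements of U, for some bracketing. *)
Inductive nprod (mu : bilin) (U : {vspace V}) : nat -> V -> Prop :=
| nprod1 x of x \in U : nprod mu U 1 x
| nprodM j k x y of nprod mu U j x & nprod mu U k y :
    nprod mu U (j + k) (mu x y).

Definition nilpotent (mu : bilin) (U : {vspace V}) : Prop :=
  exists2 k, (0 < k)%N & forall x, nprod mu U k x -> x = 0.

Definition max_nilpotent_ideal (mu : bilin) (N : {vspace V}) : Prop :=
  [/\ ideal mu fullv N, nilpotent mu N
    & forall I, ideal mu fullv I -> nilpotent mu I -> (N <= I)%VS -> I = N].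

Definition nilradical (mu : bilin) (N : {vspace V}) : Prop :=
  max_nilpotent_ideal mu N /\
  forall N', max_nilpotent_ideal mu N' -> N' = N.

(* The eigenvalues of E are exactly the integers k_1 < ... < k_r, with
   multiplicities d_1, ..., d_r; it is used for self-adjoint E only, whose
   geometric and algebraic multiplicities agree.  Integers are prime to each
   other when their gcd is 1; the gcd 0 is also accepted so that D = 0 has the
   type (0; n), and the operator on the zero space the empty type. *)
Definition int_spectrum (E : 'End(V)) (ks : seq int) (ds : seq nat) : Prop :=
  [/\ sorted <%R ks,
      (\big[gcdn/0]_(k <- ks) `|k| <= 1)%N,
      forall a : R[i], leigenvalue E a <-> a \in [seq k%:~R | k <- ks]
    & ds = [seq \dim (leigenspace E k%:~R) | k <- ks]].

Section InnerProduct.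
(* Linear in the first argument and conjugate-linear in the second one. *)
Variable ip : {dot V for Num.conj}.

Definition adj (A : 'End(V)) : 'End(V) :=
  xget 0 [set B : 'End(V) | forall x y, ip (A x) y = ip x (B y)].

Definition self_adjoint (A : 'End(V)) : Prop :=
  forall x y, ip (A x) y = ip x (A y).

Definition normal_op (A : 'End(V)) : Prop := (A \o adj A = adj A \o A)%VF.

Definition op_trace (A : 'End(V)) : R[i] :=
  \tr (mxof (vbasis fullv) (vbasis fullv) A).

Definition op_ip (A B : 'End(V)) : R[i] := op_trace (A \o adj B)%VF.

Definition orthonormal_basis (X : seq V) : Prop :=
  orthonormal ip X /\ basis_of fullv X.

(* In the definitions below, X is an orthonormal basis of V. *)
Variable X : seq V.

Definition bilin_ip (mu lambda : bilin) : R[i] :=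
  \sum_(x <- X) \sum_(y <- X) \sum_(z <- X)
    ip (mu x y) z * Num.conj (ip (lambda x y) z).

Definition Mop (mu : bilin) : 'End(V) :=
  2 *: (\sum_(x <- X) (mu x \o adj (mu x))%VF)
  - 2 *: (\sum_(x <- X) (adj (mu x) \o mu x)%VF)
  - 2 *: (\sum_(x <- X) (adj (rmult mu x) \o rmult mu x)%VF).

Definition rho (mu : bilin) (g : 'End(V)) : R :=
  complex.Re (bilin_ip (act g mu) (act g mu)).

Definition bilin_normsq (mu : bilin) : R := complex.Re (bilin_ip mu mu).

(* The differential of rho_mu at the identity, in the direction A, is computed
   along the line 1 + tA, which stays in GL(V) for small real t. *)
Definition moment (mu : bilin) : 'End(V) :=
  xget 0 [set m : 'End(V) | self_adjoint m /\
    forall A, self_adjoint A ->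
      op_ip m A =
        (derive1 (fun t : R => rho mu (\1%VF + t%:C%C *: A)) 0
           / bilin_normsq mu)%:C%C].

Definition Fn (mu : bilin) : R :=
  complex.Re (op_ip (moment mu) (moment mu)).

(* [mu] is a critical point on the projective space iff the differential at mu
   of the lift of F_n to nonzero bilinear maps is zero.  That lift is smooth, so
   its differential vanishes iff all its real directional derivatives do. *)
Definition critical_point (mu : bilin) : Prop :=
  mu != 0 /\
  forall nu : bilin,
    is_derive (0 : R) (1 : R) (fun t : R => Fn (mu + t%:C%C *: nu)) 0.

(* The variety of symmetric Leibniz structures may be singular; the critical
   points on it are those of the whole projective space that lie in it. *)
Definition critical_point_S (mu : bilin) : Prop :=
  sym_leibniz mu /\ critical_point mu.

Definition M_decomp (mu : bilin) (c : R) (D : 'End(V)) : Prop :=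
  Mop mu = c%:C%C *: \1%VF + D /\ is_der mu D.

Definition has_type (mu : bilin) (ks : seq int) (ds : seq nat) : Prop :=
  exists (c : R) (D : 'End(V)) (s : R),
    [/\ M_decomp mu c D, 0 < s & int_spectrum (s%:C%C *: D) ks ds].

End InnerProduct.
End BilinearMaps.

(* Transport of the multiplication along an injective linear map phi whose image
   is closed under it: phi (pullback phi mu x y) = mu (phi x) (phi y). *)
Definition pullback (R : realType) (W V : vectType R[i]) (phi : 'Hom(W, V))
    (mu : bilin V) : bilin W :=
  linfun (fun x => (phi^-1 \o mu (phi x) \o phi)%VF).

(* Main.v *)
(* Write A.mu for the derivative at 0 of t |-> exp(tA).mu, so that A is a
   derivation iff A.mu = 0, and tr(M A) = 2 <A.mu, mu>.  For M = c I + D this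
   gives tr(M^2) = - 2 c |mu|^2, hence c < 0, and tr(M [E, E^*]) = 2 |E^*.mu|^2
   for a derivation E; the left-hand side vanishes when E commutes with D, and
   then E^* is a derivation too.  This applies to the left and right
   multiplications by elements of l_0.

   An element of l_0 annihilating the algebra satisfies
   c |u|^2 = <M u, u> >= 0 and is zero.  The adjoints of L_A and R_A, being
   derivations, preserve the annihilator, so that A y + y A, which belongs to
   it, is also orthogonal to it: R_A = - L_A for A in l_0.  The rest of the
   structure of l_0 follows from the same trick of applying the derivation
   L_A^* to products.

   For the restriction nu of mu to l_+, the difference between M on l_+ and
   M_nu is 4 times the sum of [L_A, L_A^*] over an orthonormal basis of l_0.
   This is - 4 L_w with w the sum of the L_A^* A; up to sign, <x, w> is
   the trace of the adjoint action of x on the reductive, hence unimodular, Lie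
   algebra l_0, so w = 0.  Finally, the critical points are characterized by
   computing the derivative of F along a line, which vanishes because
   M.mu = - c mu. *)

Require Import Defs.
From HB Require Import structures.
From mathcomp Require Import all_boot all_order all_algebra.
From mathcomp Require Import sesquilinear spectral.
From mathcomp Require Import all_classical all_reals all_analysis.
From mathcomp Require Import complex ring.

Set Implicit Arguments.
Unset Strict Implicit.
Unset Printing Implicit Defensive.

Import Order.TTheory GRing.Theory Num.Theory.
Import passmx numFieldNormedType.Exports.
Local Open Scope ring_scope.

(** * Bilinear maps and traces *)

Section Bilinear.
Variables (R : realType) (V : vectType R[i]).
Implicit Types (A B E : 'End(V)) (mu nu : bilin V).

(** [linfun] is applied to bare functions throughout, so the linear structure that [lfunE] needs is
    packed here from a proof of linearity. *)
Lemma linear_lfunE (U W : vectType R[i]) (f : U -> W) :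
  linear f -> linfun f =1 f.
Proof.
move=> lf x.
pose L := GRing.isLinear.Build R[i] U W *:%R f lf.
pose g : {linear U -> W} := HB.pack f L.
by rewrite -[f]/(g : U -> W) lfunE.
Qed.

(* Unlike the generic [linear0], [linearD], and so on, these do not match the
   operations on ['Hom(U, W)] themselves. *)
Lemma hom0 (U W : vectType R[i]) (f : 'Hom(U, W)) : f 0 = 0.
Proof. exact: linear0. Qed.

Lemma homD (U W : vectType R[i]) (f : 'Hom(U, W)) x y : f (x + y) = f x + f y.
Proof. exact: linearD. Qed.

Lemma homN (U W : vectType R[i]) (f : 'Hom(U, W)) x : f (- x) = - f x.
Proof. exact: linearN. Qed.

Lemma homB (U W : vectType R[i]) (f : 'Hom(U, W)) x y : f (x - y) = f x - f y.
Proof. exact: linearB. Qed.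

Lemma homZ (U W : vectType R[i]) (f : 'Hom(U, W)) a x : f (a *: x) = a *: f x.
Proof. exact: linearZ. Qed.

Lemma hom_sum (U W : vectType R[i]) (f : 'Hom(U, W)) (I : Type) (r : seq I)
    (P : pred I) (F : I -> U) :
  f (\sum_(i <- r | P i) F i) = \sum_(i <- r | P i) f (F i).
Proof. exact: linear_sum. Qed.

Lemma bilinDl mu x y z : mu (x + y) z = mu x z + mu y z.
Proof. by rewrite linearD lfunE. Qed.

Lemma bilinBl mu x y z : mu (x - y) z = mu x z - mu y z.
Proof. by rewrite linearB !lfunE/= lfunE. Qed.

Lemma bilinZl mu a x z : mu (a *: x) z = a *: mu x z.
Proof. by rewrite linearZ lfunE. Qed.

Lemma bilin0l mu z : mu 0 z = 0.
Proof. by rewrite linear0 lfunE. Qed.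

Lemma bilin_suml mu (I : Type) (r : seq I) (P : pred I) (F : I -> V) z :
  mu (\sum_(i <- r | P i) F i) z = \sum_(i <- r | P i) mu (F i) z.
Proof. by rewrite linear_sum sum_lfunE. Qed.

Lemma rmultE mu x y : rmult mu x y = mu y x.
Proof.
apply: (@linear_lfunE _ _ (fun y => mu y x)) => a u v.
by rewrite bilinDl bilinZl.
Qed.

Lemma actE (g : 'End(V)) mu x y :
  act g mu x y = g (mu ((g^-1)%VF x) ((g^-1)%VF y)).
Proof.
rewrite linear_lfunE ?comp_lfunE// => a u v; apply/lfunP => z.
rewrite !(comp_lfunE, add_lfunE, scale_lfunE).
by rewrite (linearP (g^-1)%VF) bilinDl bilinZl linearP.
Qed.

(* The infinitesimal action A.mu *)
Definition dact A mu : bilin V :=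
  linfun (fun x => (A \o mu x)%VF - mu (A x) - (mu x \o A)%VF).

Lemma dactE A mu x y : dact A mu x y = A (mu x y) - mu (A x) y - mu x (A y).
Proof.
rewrite linear_lfunE ?(add_lfunE, opp_lfunE, comp_lfunE)// => a u v.
apply/lfunP => z.
rewrite !(comp_lfunE, add_lfunE, opp_lfunE, scale_lfunE).
rewrite !(bilinDl, bilinZl) !linearP/= !(add_lfunE, scale_lfunE) !scalerBr.
by rewrite !opprD !scalerN [RHS]addrACA (addrACA (a *: A _)).
Qed.

Lemma bilinE0 x y : (0 : bilin V) x y = 0.
Proof. by rewrite !zero_lfunE. Qed.

Lemma bilinED mu nu x y : (mu + nu) x y = mu x y + nu x y.
Proof. by rewrite !add_lfunE. Qed.

Lemma bilinEN mu x y : (- mu) x y = - mu x y.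
Proof. by rewrite !opp_lfunE. Qed.

Lemma bilinEZ a mu x y : (a *: mu) x y = a *: mu x y.
Proof. by rewrite !scale_lfunE. Qed.

Lemma bilinP mu nu : (forall x y, mu x y = nu x y) -> mu = nu.
Proof. by move=> h; apply/lfunP => x; apply/lfunP => y. Qed.

Lemma is_derP mu A : is_der mu A <-> dact A mu = 0.
Proof.
split=> [dA|d0 x y].
  by apply: bilinP => x y; rewrite dactE dA bilinE0 addrAC addrK subrr.
have: dact A mu x y = 0 by rewrite d0 bilinE0.
by rewrite dactE -addrA -opprD => /eqP; rewrite subr_eq0 => /eqP.
Qed.

Lemma dactD A B mu : dact (A + B) mu = dact A mu + dact B mu.
Proof.
apply: bilinP => x y; rewrite bilinED !dactE !add_lfunE bilinDl (linearD (mu x)).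
by rewrite !opprD [RHS]addrACA (addrACA (A _)).
Qed.

Lemma dactZ a A mu : dact (a *: A) mu = a *: dact A mu.
Proof.
apply: bilinP => x y; rewrite bilinEZ !dactE !scale_lfunE bilinZl (linearZ_LR (mu x)).
by rewrite !scalerBr.
Qed.

Lemma dact1 mu : dact \1%VF mu = - mu.
Proof. by apply: bilinP => x y; rewrite bilinEN dactE !id_lfunE subrr sub0r. Qed.

Lemma is_derZ mu a A : is_der mu A -> is_der mu (a *: A).
Proof. by rewrite !is_derP dactZ => ->; rewrite scaler0. Qed.

(** [dact] is a representation of the commutator Lie algebra: [[E, A].mu = E.(A.mu) - A.(E.mu)], and
    [E.mu = 0]. *)
Lemma dact_commr A E mu : is_der mu E ->
  dact ((E \o A) - (A \o E))%VF mu = dact E (dact A mu).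
Proof.
move=> dE; apply: bilinP => x y.
rewrite !dactE !(add_lfunE, opp_lfunE, comp_lfunE) !bilinBl !homB !dE.
rewrite !homD !opprD !opprK !addrA.
by rewrite [RHS](ACl (1*6*9*2*7*5*11*(10*3)*(8*4)))/= !subrr !addr0.
Qed.

Lemma op_traceM A B : op_trace (A \o B)%VF = op_trace (B \o A)%VF.
Proof.
have bV : basis_of fullv (vbasis fullv : seq V) := vbasisP _.
by rewrite /op_trace !(mxof_comp _ _ bV) mxtrace_mulC.
Qed.

Lemma op_traceD A B : op_trace (A + B) = op_trace A + op_trace B.
Proof. by rewrite /op_trace linearD mxtraceD. Qed.

Lemma op_trace0 : op_trace (0 : 'End(V)) = 0.
Proof. by rewrite /op_trace !linear0. Qed.

Lemma op_trace_sum (I : Type) (r : seq I) (P : pred I) (F : I -> 'End(V)) :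
  op_trace (\sum_(i <- r | P i) F i) = \sum_(i <- r | P i) op_trace (F i).
Proof.
by elim/big_rec2: _ => [|i a b _ <-]; rewrite (op_trace0, op_traceD).
Qed.

Lemma comp_lfun_suml (I : Type) (r : seq I) (P : pred I) (F : I -> 'End(V)) A :
  ((\sum_(i <- r | P i) F i) \o A)%VF = \sum_(i <- r | P i) (F i \o A)%VF.
Proof.
apply/lfunP => x; rewrite comp_lfunE !sum_lfunE.
by apply: eq_bigr => i _; rewrite comp_lfunE.
Qed.

Lemma op_traceN A : op_trace (- A) = - op_trace A.
Proof. by rewrite /op_trace !linearN. Qed.

Lemma op_traceZ a A : op_trace (a *: A) = a * op_trace A.
Proof. by rewrite /op_trace linearZ mxtraceZ. Qed.

End Bilinear.

(** * Products of subspaces, nilpotency and solvability *)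

Section ProductSpace.
Variables (R : realType) (V : vectType R[i]) (mu : bilin V).
Implicit Types (U W : {vspace V}) (x y : V).

Lemma prod_space_mul U W x y :
  x \in U -> y \in W -> mu x y \in prod_space mu U W.
Proof.
move=> xU yW; rewrite (coord_vbasis xU) (coord_vbasis yW) bilin_suml.
apply: memv_suml => i _; rewrite bilinZl memvZ// hom_sum.
apply: memv_suml => j _; rewrite homZ memvZ// memv_span//.
by apply: allpairs_f; rewrite mem_nth// size_tuple.
Qed.

Lemma prod_space_sub U W (S : {vspace V}) :
  (forall x y, x \in U -> y \in W -> mu x y \in S) -> (prod_space mu U W <= S)%VS.
Proof.
move=> h; apply/span_subvP => z /allpairsP[[x y] /= [xU yW ->]].
by rewrite h// vbasis_mem.
Qed.

(* Merge two adjacent factors. *)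
Lemma nprod_pred U k x : (forall x y, x \in U -> y \in U -> mu x y \in U) ->
  nprod mu U k x -> (1 < k)%N -> nprod mu U k.-1 x.
Proof.
move=> mulU; elim=> {k x} [//|j k x y nx IHx ny IHy _].
case: (ltnP 1 j) => [j1|].
  by rewrite -(ltn_predK j1) addSn; apply: nprodM (IHx j1) ny.
case: (ltnP 1 k) => [k1 _|].
  by rewrite -(ltn_predK k1) addnS; apply: nprodM nx (IHy k1).
have gt0 m z : nprod mu U m z -> (0 < m)%N.
  by elim=> // {}m n ? ? _ m0 _ _; rewrite addn_gt0 m0.
have n1 m z : nprod mu U m z -> (m <= 1)%N -> z \in U.
  by move=> nz; case: nz => // {}m n a b /gt0 m0 /gt0 n0; rewrite leqNgt -addn1 leq_add.
move=> k1 j1; have -> : (j + k).-1 = 1%N.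
  by have := gt0 _ _ nx; have := gt0 _ _ ny; case: (j) j1 (k) k1 => [|[]] // _ [|[]].
by apply/nprod1/mulU; [exact: n1 nx j1|exact: n1 ny k1].
Qed.

Lemma nilpotent_nprod U k : (forall x y, x \in U -> y \in U -> mu x y \in U) ->
  (forall x, nprod mu U k x -> x = 0) -> (0 < k)%N ->
  forall j x, (k <= j)%N -> nprod mu U j x -> x = 0.
Proof.
move=> mulU nil0 k0 j; elim: j => [|j IHj] x; first by case: (k) k0.
rewrite leq_eqVlt => /predU1P[<-|]; first exact: nil0.
rewrite ltnS => kj /(nprod_pred mulU)/=; rewrite ltnS => h.
by apply: IHj => //; apply: h; exact: leq_trans kj.
Qed.

(** The j-th derived space lies in the span of the products of [2 ^ j] elements, and [k < 2 ^ k]. *)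
Lemma nilpotent_solvable U : (forall x y, x \in U -> y \in U -> mu x y \in U) ->
  nilpotent mu U -> solvable mu U.
Proof.
move=> mulU [k k0 nil0].
(* [Sp j x]: [x] belongs to the linear span of the products of [j] elements *)
pose Sp j x := forall W : {vspace V}, (forall y, nprod mu U j y -> y \in W) -> x \in W.
(* Bilinearity passes from products to spans one factor at a time, through preimages of [W] under a
   left and then a right multiplication. *)
have SpM j l x y : Sp j x -> Sp l y -> Sp (j + l)%N (mu x y).
  move=> sx sy W hW.
  have h a : nprod mu U j a -> mu a y \in W.
    move=> na; rewrite memv_preim; apply: sy => b nb.
    by rewrite -memv_preim; apply/hW/nprodM.
  by rewrite -rmultE memv_preim; apply: sx => a na; rewrite -memv_preim rmultE h.
have SpI j x : x \in iter j (fun W => prod_space mu W W) U -> Sp (2 ^ j)%N x.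
  elim: j x => [|j IHj] x /=; first by move=> xU W hW; apply/hW/nprod1.
  move=> xj W hW; apply: subvP xj; apply: prod_space_sub => a b aj bj.
  by move: W hW; rewrite expnS mul2n -addnn; apply: SpM; exact: IHj.
exists k; apply/eqP; rewrite -subv0; apply/subvP => x /SpI; apply => y ny.
rewrite memv0; apply/eqP; apply: (nilpotent_nprod mulU nil0 k0 _ ny).
by rewrite ltnW// ltn_expl.
Qed.

(** The ideal absorbs [x] in the innermost product [mu a x], which counts as a single factor; this
    gives [k.+1] factors for an arbitrary [x]. *)
Lemma nprod_iter U k a x : ideal mu fullv U -> a \in U ->
  nprod mu U k.+1 (iter k.+1 (mu a) x).
Proof.
move=> [_ idU] aU; elim: k => [|k IHk] /=.
  by apply/nprod1; apply: (idU x a _ _).2; rewrite ?memvf.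
by rewrite -add1n; apply: nprodM IHk; exact: nprod1.
Qed.

End ProductSpace.

(** * Frames and adjoints *)

Section Frames.
Variables (R : realType) (V : vectType R[i]) (ip : {dot V for Num.conj}).
Implicit Types (A B E : 'End(V)) (u v w : V).
Local Notation "''[' u , v ]" := (ip u v) : ring_scope.

Lemma ipC u v : '[u, v] = Num.conj '[v, u].
Proof. by rewrite (hermC ip) mul1r. Qed.

Lemma ipDl u v w : '[u + v, w] = '[u, w] + '[v, w].
Proof. exact: linearDl. Qed.

Lemma ipBl u v w : '[u - v, w] = '[u, w] - '[v, w].
Proof. exact: linearBl. Qed.

Lemma ipNl u w : '[- u, w] = - '[u, w].
Proof. exact: linearNl. Qed.

Lemma ipZl a u w : '[a *: u, w] = a * '[u, w].
Proof. exact: linearZl_LR. Qed.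

Lemma ip0l w : '[0, w] = 0.
Proof. exact: linear0l. Qed.

Lemma ip_suml (I : Type) (r : seq I) (P : pred I) (F : I -> V) w :
  '[\sum_(i <- r | P i) F i, w] = \sum_(i <- r | P i) '[F i, w].
Proof. exact: linear_sumlz. Qed.

Lemma ipDr u v w : '[w, u + v] = '[w, u] + '[w, v].
Proof. exact: linearDr. Qed.

Lemma ipBr u v w : '[w, u - v] = '[w, u] - '[w, v].
Proof. exact: linearBr. Qed.

Lemma ipNr u w : '[w, - u] = - '[w, u].
Proof. exact: linearNr. Qed.

Lemma ipZr a u w : '[w, a *: u] = Num.conj a * '[w, u].
Proof. exact: linearZr_LR. Qed.

Lemma ip0r w : '[w, 0] = 0.
Proof. exact: linear0r. Qed.

Lemma ip_sumr (I : Type) (r : seq I) (P : pred I) (F : I -> V) w :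
  '[w, \sum_(i <- r | P i) F i] = \sum_(i <- r | P i) '[w, F i].
Proof. exact: linear_sumr. Qed.

Lemma ip_eq0 u : '[u, u] = 0 -> u = 0.
Proof. by move/eqP; rewrite dnorm_eq0 => /eqP. Qed.

Lemma ip_inj u v : (forall w, '[w, u] = '[w, v]) -> u = v.
Proof.
move=> h; apply/eqP; rewrite -subr_eq0; apply/eqP/ip_eq0.
by rewrite ipBr h subrr.
Qed.

Lemma ip_injl u v : (forall w, '[u, w] = '[v, w]) -> u = v.
Proof. by move=> h; apply: ip_inj => w; rewrite ipC h -ipC. Qed.

Lemma ortho_decomp (W : {vspace V}) v :
  exists2 w, w \in W & forall y, y \in W -> '[v - w, y] = 0.
Proof.
have [w wW [z [vE _ oz]]] := orthogonal_split ip (vbasis W) v.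
have sW : <<vbasis W>>%VS = W := span_basis (vbasisP W).
exists w => [|y yW]; first by rewrite -sW.
rewrite vE addrAC subrr add0r.
by apply: (span_orthogonal oz); rewrite ?memv_span1 ?sW.
Qed.

Lemma mem_orthov_ip (W : {vspace V}) u :
  u \in orthov ip W <-> forall y, y \in W -> '[u, y] = 0.
Proof.
by split=> [/mem_orthovP h y yW|h]; [exact: h|apply/mem_orthovP => y /h].
Qed.

(* A Parseval frame.  Unlike orthonormal bases, frames stay frames under the
   orthogonal projection to a subspace (of that subspace), so that bases never
   have to be adapted to subspaces; traces can be computed with them as well. *)
Definition frame (I : finType) (e : I -> V) :=
  forall v, v = \sum_i '[v, e i] *: e i.

Lemma onb_frame (X : seq V) : orthonormal_basis ip X ->
  frame (tnth (in_tuple X)).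
Proof.
case=> /orthonormalP[uX oX] bX v.
rewrite [LHS](coord_basis (bX : basis_of _ (in_tuple X)) (memvf v)).
apply: eq_bigr => i _; rewrite -(tnth_nth 0); congr (_ *: _).
rewrite [in RHS](coord_basis (bX : basis_of _ (in_tuple X)) (memvf v)) ip_suml.
rewrite (bigD1 i)//= big1 ?addr0 => [|j ji].
  by rewrite -[_`_i](tnth_nth 0 (in_tuple X)) ipZl oX ?mem_tnth// eqxx mulr1.
rewrite -[_`_j](tnth_nth 0 (in_tuple X)) ipZl oX ?mem_tnth//.
by rewrite !(tnth_nth 0)/= nth_uniq// (inj_eq val_inj) (negPf ji) mulr0.
Qed.

Lemma big_onb (W : nmodType) (X : seq V) (F : V -> W) :
  \sum_(x <- X) F x = \sum_i F (tnth (in_tuple X) i).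
Proof. by rewrite big_tnth. Qed.

Section Frame.
Variables (I : finType) (e : I -> V).
Hypothesis fr : frame e.

Lemma parseval u v : '[u, v] = \sum_i '[u, e i] * '[e i, v].
Proof. by rewrite [u in LHS]fr ip_suml; apply: eq_bigr => i _; rewrite ipZl. Qed.

Lemma frame_hom_eq (W : vectType R[i]) (A B : 'Hom(V, W)) :
  (forall i, A (e i) = B (e i)) -> A = B.
Proof.
move=> h; apply/lfunP => v; rewrite (fr v) !hom_sum.
by apply: eq_bigr => i _; rewrite !homZ h.
Qed.

Lemma adjP A u v : '[A u, v] = '[u, adj ip A v].
Proof.
rewrite /adj; case: xgetP => [B _ ->//|].
(* The default value 0 of [xget] is excluded by exhibiting an adjoint through its frame
   coefficients. *)
move=> /(_ (linfun (fun v => \sum_i '[v, A (e i)] *: e i))) [].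
move=> x y; rewrite linear_lfunE => [|a w z].
  rewrite ip_sumr [x in LHS]fr hom_sum ip_suml.
  by apply: eq_bigr => i _; rewrite homZ ipZl ipZr -ipC mulrC.
rewrite scaler_sumr -big_split/=; apply: eq_bigr => i _.
by rewrite ipDl ipZl scalerDl scalerA.
Qed.

Lemma adjPr A u v : '[u, A v] = '[adj ip A u, v].
Proof. by rewrite ipC adjP -ipC. Qed.

Lemma adj_uniq A B : (forall u v, '[A u, v] = '[u, B v]) -> adj ip A = B.
Proof.
by move=> h; apply/lfunP => v; apply: ip_inj => w; rewrite -adjP h.
Qed.

Lemma adjK A : adj ip (adj ip A) = A.
Proof. by apply: adj_uniq => u v; rewrite -adjPr. Qed.

Lemma adjD A B : adj ip (A + B) = adj ip A + adj ip B.
Proof. by apply: adj_uniq => u v; rewrite !add_lfunE ipDl ipDr !adjP. Qed.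

Lemma adjN A : adj ip (- A) = - adj ip A.
Proof. by apply: adj_uniq => u v; rewrite !opp_lfunE ipNl ipNr !adjP. Qed.

Lemma adjZ a A : adj ip (a *: A) = Num.conj a *: adj ip A.
Proof. by apply: adj_uniq => u v; rewrite !scale_lfunE ipZl ipZr conjCK adjP. Qed.

Lemma adj_comp A B : adj ip (A \o B)%VF = (adj ip B \o adj ip A)%VF.
Proof. by apply: adj_uniq => u v; rewrite !comp_lfunE !adjP. Qed.

Lemma self_adjoint_adj A : self_adjoint ip A -> adj ip A = A.
Proof. exact: adj_uniq. Qed.

(** Expanding the images of the basis vectors in the frame and exchanging the sums reassembles each
    [e i] from its basis coordinates. *)
Lemma op_trace_frame A : op_trace A = \sum_i '[A (e i), e i].
Proof.
rewrite /op_trace /mxtrace; under eq_bigr => j _.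
  rewrite mxE/= mxE vecof_delta (fr (A _)) linear_sum/=.
  under eq_bigr => i _ do rewrite linearZ/= mulrC -ipZl -homZ.
  over.
rewrite exchange_big; apply: eq_bigr => i _ /=.
rewrite -ip_suml -hom_sum; congr '[A _, _].
by rewrite -coord_vbasis// memvf.
Qed.

Lemma op_trace_adj A B :
  \sum_i '[A (e i), B (e i)] = op_trace (adj ip B \o A)%VF.
Proof.
by rewrite op_trace_frame; apply: eq_bigr => i _; rewrite comp_lfunE -adjPr.
Qed.

Lemma op_ip_eq0 A : op_ip ip A A = 0 -> A = 0.
Proof.
rewrite /op_ip => t0.
have {t0}: \sum_i '[adj ip A (e i), adj ip A (e i)] = 0.
  by rewrite op_trace_adj adjK.
move/eqP; rewrite psumr_eq0 => [|i _]; last exact: dnorm_ge0.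
move=> /allP h; have: adj ip A = 0.
  apply: frame_hom_eq => i; rewrite zero_lfunE; apply: ip_eq0; apply/eqP.
  by apply: h; rewrite mem_index_enum.
by move=> A0; rewrite -(adjK A) A0; apply: adj_uniq => u v; rewrite !lfunE/= ip0l ip0r.
Qed.

(** The kernel of a normal operator is killed by its adjoint, so a vector of the image that [A]
    kills is orthogonal to itself. *)
Lemma normal_iter_eq0 A x k : normal_op ip A -> iter k.+1 A x = 0 -> A x = 0.
Proof.
move=> nA; elim: k => // k IHk AA0; apply: IHk.
set y := iter k.+1 A x; have yE : y = A (iter k A x) by [].
have Ay : A y = 0 := AA0.
have h : adj ip A y = 0.
  apply: ip_eq0; rewrite -adjPr.
  by move/lfunP/(_ y): nA; rewrite !comp_lfunE Ay hom0 => ->; rewrite ip0r.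
by apply: ip_eq0; rewrite {1}yE adjP h ip0r.
Qed.

(** Both sides are traces of the same three operators in cyclic order. *)
Lemma sum_adj_frame (W : vectType R[i]) (ipW : {dot W for Num.conj})
    (F G : 'Hom(V, W)) A :
  \sum_i ipW (F (A (e i))) (G (e i)) =
  \sum_i ipW (F (e i)) (G (adj ip A (e i))).
Proof.
under eq_bigr => i _.
  rewrite (fr (A (e i))) hom_sum linear_sumlz.
  under eq_bigr => j _ do rewrite homZ linearZl_LR/=.
  over.
under [RHS]eq_bigr => i _.
  rewrite (fr (adj ip A (e i))) hom_sum linear_sumr.
  under eq_bigr => j _ do rewrite homZ linearZr_LR/= -ipC adjPr adjK.
  over.
rewrite exchange_big; apply: eq_bigr => i _; apply: eq_bigr => j _ //=.
Qed.

End Frame.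
End Frames.

(** * The operator M and critical points *)

Section TraceFormula.
Variables (R : realType) (V : vectType R[i]) (ip : {dot V for Num.conj}).
Implicit Types (A B E : 'End(V)) (mu nu : bilin V).
Local Notation "''[' u , v ]" := (ip u v) : ring_scope.

(** The Hermitian product of bilinear maps; the third index of [bilin_ip] is summed out by
    Parseval. *)
Definition bip (I : finType) (e : I -> V) mu nu : R[i] :=
  \sum_i \sum_j '[mu (e i) (e j), nu (e i) (e j)].

(* Polarization of [Mop] *)
Definition Mop2 (I : finType) (e : I -> V) mu nu : 'End(V) :=
  2 *: (\sum_i (mu (e i) \o adj ip (nu (e i)))%VF)
  - 2 *: (\sum_i (adj ip (nu (e i)) \o mu (e i))%VF)
  - 2 *: (\sum_i (adj ip (rmult nu (e i)) \o rmult mu (e i))%VF).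

Section Frame.
Variables (I : finType) (e : I -> V).
Hypothesis fr : frame ip e.

(** Each inner sum is a trace, so the frame can be changed in one argument at a time. *)
Lemma bip_frame (J : finType) (f : J -> V) mu nu :
  frame ip f -> bip e mu nu = bip f mu nu.
Proof.
move=> ff; rewrite /bip.
under eq_bigr => i _ do rewrite (op_trace_adj fr) -(op_trace_adj ff).
rewrite exchange_big [RHS]exchange_big; apply: eq_bigr => j _ /=.
under eq_bigr => i _ do rewrite -!rmultE.
under [RHS]eq_bigr => i _ do rewrite -!rmultE.
by rewrite (op_trace_adj fr) -(op_trace_adj ff).
Qed.

Lemma bilin_ip_frame (X : seq V) mu nu :
  orthonormal_basis ip X -> bilin_ip ip X mu nu = bip e mu nu.
Proof.
move=> /onb_frame fX; rewrite (bip_frame _ _ fX) /bilin_ip big_onb.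
apply: eq_bigr => i _; rewrite big_onb; apply: eq_bigr => j _; rewrite big_onb.
by rewrite [RHS](parseval fX); apply: eq_bigr => k _; rewrite -ipC.
Qed.

Lemma bipC mu nu : bip e mu nu = Num.conj (bip e nu mu).
Proof.
rewrite /bip rmorph_sum; apply: eq_bigr => i _ /=.
by rewrite rmorph_sum; apply: eq_bigr => j _ /=; rewrite -ipC.
Qed.

Lemma bipDl mu nu la : bip e (mu + nu) la = bip e mu la + bip e nu la.
Proof.
rewrite -big_split; apply: eq_bigr => i _; rewrite -big_split.
by apply: eq_bigr => j _; rewrite bilinED ipDl.
Qed.

Lemma bipZl a mu la : bip e (a *: mu) la = a * bip e mu la.
Proof.
rewrite mulr_sumr; apply: eq_bigr => i _; rewrite mulr_sumr.
by apply: eq_bigr => j _; rewrite bilinEZ ipZl.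
Qed.

Lemma bipDr mu nu la : bip e la (mu + nu) = bip e la mu + bip e la nu.
Proof. by rewrite bipC bipDl rmorphD/= -!bipC. Qed.

Lemma bipZr a mu la : bip e la (a *: mu) = Num.conj a * bip e la mu.
Proof. by rewrite bipC bipZl rmorphM/= -bipC. Qed.

Lemma bip_ge0 mu : 0 <= bip e mu mu.
Proof. by apply: sumr_ge0 => i _; apply: sumr_ge0 => j _; exact: dnorm_ge0. Qed.

Lemma bip_eq0 mu : bip e mu mu = 0 -> mu = 0.
Proof.
move=> /eqP; rewrite psumr_eq0 => [/allP h|i _]; last first.
  by apply: sumr_ge0 => j _; exact: dnorm_ge0.
apply: (frame_hom_eq fr) => i; apply: (frame_hom_eq fr) => j.
rewrite !zero_lfunE; apply: ip_eq0; apply/eqP.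
have := h i; rewrite mem_index_enum => /(_ isT).
rewrite psumr_eq0 => [/allP/(_ j)|k _]; last exact: dnorm_ge0.
by rewrite mem_index_enum; apply.
Qed.

(** The action on bilinear maps takes adjoints to adjoints; its three terms are moved across
    separately. *)
Lemma bip_dact A mu nu :
  bip e (dact A mu) nu = bip e mu (dact (adj ip A) nu).
Proof.
rewrite /bip.
under eq_bigr => i _ do under eq_bigr => j _ do rewrite dactE !ipBl.
under [RHS]eq_bigr => i _ do under eq_bigr => j _ do rewrite dactE !ipBr.
under eq_bigr => i _ do rewrite !sumrB.
under [RHS]eq_bigr => i _ do rewrite !sumrB.
rewrite !sumrB; congr (_ - _ - _).
- by apply: eq_bigr => i _; apply: eq_bigr => j _; rewrite (adjP fr).
- rewrite exchange_big [RHS]exchange_big; apply: eq_bigr => j _ /=.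
  under eq_bigr => i _ do rewrite -!rmultE.
  under [RHS]eq_bigr => i _ do rewrite -!rmultE.
  exact: sum_adj_frame.
- by apply: eq_bigr => i _; exact: sum_adj_frame.
Qed.

Lemma ip_Mop2 mu nu u v :
  '[Mop2 e mu nu u, v] =
    2 * (\sum_i '[adj ip (nu (e i)) u, adj ip (mu (e i)) v])
    - 2 * (\sum_i '[mu (e i) u, nu (e i) v])
    - 2 * (\sum_i '[mu u (e i), nu v (e i)]).
Proof.
rewrite !(add_lfunE, opp_lfunE, scale_lfunE, sum_lfunE).
rewrite !(ipDl, ipNl, ipZl, ip_suml); congr (_ * _ - _ * _ - _ * _).
- by apply: eq_bigr => i _; rewrite comp_lfunE [LHS](adjP fr).
- by apply: eq_bigr => i _; rewrite comp_lfunE -[LHS](adjPr fr).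
- by apply: eq_bigr => i _; rewrite comp_lfunE -[LHS](adjPr fr) !rmultE.
Qed.

(** The moment map identity in polarized form: by cyclicity of the trace, each of the three sums in
    [Mop2] gives one of the three terms of the action. *)
Lemma op_trace_Mop2 A mu nu :
  op_trace (Mop2 e mu nu \o A)%VF = 2 * bip e (dact A mu) nu.
Proof.
rewrite /Mop2 !comp_lfunDl !comp_lfunNl -!comp_lfunZl.
rewrite !(op_traceD, op_traceN, op_traceZ) -!mulrBr; congr (2 * _).
rewrite !comp_lfun_suml !op_trace_sum /bip.
under [RHS]eq_bigr => i _ do under eq_bigr => j _ do rewrite dactE !ipBl.
under [RHS]eq_bigr => i _ do rewrite !sumrB.
rewrite !sumrB [RHS]addrAC; congr (_ - _ - _).
- apply: eq_bigr => i _; rewrite -comp_lfunA op_traceM -comp_lfunA.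
  rewrite -(op_trace_adj fr); apply: eq_bigr => j _.
  by rewrite comp_lfunE.
- apply: eq_bigr => i _; rewrite -comp_lfunA -(op_trace_adj fr).
  by apply: eq_bigr => j _; rewrite comp_lfunE.
- rewrite [RHS]exchange_big; apply: eq_bigr => i _ /=.
  rewrite -comp_lfunA -(op_trace_adj fr).
  by apply: eq_bigr => j _; rewrite comp_lfunE !rmultE.
Qed.

Lemma adj_Mop2 mu nu : adj ip (Mop2 e mu nu) = Mop2 e nu mu.
Proof.
apply: adj_uniq => // u v; rewrite [RHS]ipC !ip_Mop2.
rewrite !(rmorphB, rmorphM, rmorph_nat, rmorph_sum)/=.
by congr (_ * _ - _ * _ - _ * _); apply: eq_bigr => i _; rewrite -ipC.
Qed.

(** The trace form is nondegenerate: take for [E] the adjoint of [A - B]. Identities between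
    operators [Mop2] thus reduce to identities for [bip]. *)
Lemma op_trace_eq A B :
  (forall E, op_trace (A \o E)%VF = op_trace (B \o E)%VF) -> A = B.
Proof.
move=> h; apply/eqP; rewrite -subr_eq0; apply/eqP/(op_ip_eq0 fr).
by rewrite /op_ip comp_lfunDl comp_lfunNl op_traceD op_traceN h subrr.
Qed.

End Frame.

Lemma Mop_frame (I : finType) (e : I -> V) (X : seq V) mu :
  frame ip e -> orthonormal_basis ip X -> Mop ip X mu = Mop2 e mu mu.
Proof.
move=> fr /onb_frame fX; rewrite /Mop !big_onb.
rewrite -/(Mop2 (tnth (in_tuple X)) mu mu); apply: (op_trace_eq fr) => E.
by rewrite !op_trace_Mop2// (bip_frame fX _ _ fr).
Qed.

(** * Consequences of the decomposition M = c I + D *)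

Section Critical.
Variables (I : finType) (e : I -> V).
Hypothesis fr : frame ip e.
Variables (mu : bilin V) (c : R) (D : 'End(V)).
Hypothesis MD : Mop2 e mu mu = c%:C%C *: \1%VF + D.

Lemma critical_der_adj E : is_der mu E -> (D \o E = E \o D)%VF ->
  is_der mu (adj ip E).
Proof.
move=> dE DE; rewrite is_derP; apply: (bip_eq0 fr).
have ME : (Mop2 e mu mu \o E = E \o Mop2 e mu mu)%VF.
  rewrite MD comp_lfunDl comp_lfunDr DE -comp_lfunZl -comp_lfunZr.
  by rewrite comp_lfun1l comp_lfun1r.
rewrite -(bip_dact fr) -dact_commr//.
apply: (mulfI (_ : 2 != 0 :> R[i])); first by rewrite pnatr_eq0.
rewrite -(op_trace_Mop2 fr) comp_lfunDr comp_lfunNr op_traceD op_traceN mulr0.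
by rewrite comp_lfunA ME -comp_lfunA op_traceM -comp_lfunA subrr.
Qed.

Hypothesis dD : is_der mu D.
Hypothesis mu0 : mu != 0.

Lemma bip_gt0 : 0 < bip e mu mu.
Proof.
by rewrite lt_def bip_ge0 andbT; apply/eqP => /(bip_eq0 fr) /eqP; apply/negP.
Qed.

Lemma conj_realC (x : R) : Num.conj x%:C%C = x%:C%C.
Proof. by apply/CrealP; rewrite complex_real. Qed.

Lemma bip_dact_critical nu : bip e (dact (Mop2 e mu mu) mu) nu =
  - c%:C%C * bip e mu nu.
Proof.
rewrite MD dactD (is_derP mu D).1// addr0 dactZ dact1 bipZl.
by rewrite -scaleN1r bipZl mulrA mulrN1.
Qed.

Lemma op_trace_Mop2_sqr :
  op_trace (Mop2 e mu mu \o Mop2 e mu mu)%VF = - 2 * c%:C%C * bip e mu mu.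
Proof. by rewrite (op_trace_Mop2 fr) bip_dact_critical mulrA mulrN mulNr. Qed.

(** The trace of the square of M is nonnegative, which gives [c <= 0]. If [c = 0] then M = 0, and
    testing the trace formula on the identity, which acts by -1, makes the norm of [mu] vanish. *)
Lemma critical_scalar_lt0 : c < 0.
Proof.
have tE : op_ip ip (Mop2 e mu mu) (Mop2 e mu mu) = - 2 * c%:C%C * bip e mu mu.
  by rewrite /op_ip (adj_Mop2 fr) op_trace_Mop2_sqr.
have t0 : 0 <= op_ip ip (Mop2 e mu mu) (Mop2 e mu mu).
  rewrite /op_ip (adj_Mop2 fr) -[X in (X \o _)%VF](adj_Mop2 fr) -(op_trace_adj fr).
  by apply: sumr_ge0 => i _; exact: dnorm_ge0.
rewrite lt_neqAle; apply/andP; split; last first.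
  move: t0; rewrite tE !mulNr oppr_ge0 pmulr_lle0 ?bip_gt0//.
  by rewrite pmulr_rle0 ?ltr0n// -[0]/(0%:C%C) lecR.
apply/eqP => c0; move: tE; rewrite c0 mulr0 mul0r => /(op_ip_eq0 fr) M0.
have := op_trace_Mop2 fr \1%VF mu mu.
rewrite M0 comp_lfun0l op_trace0 dact1 -scaleN1r bipZl mulN1r mulrN.
move/eqP; rewrite eq_sym oppr_eq0 mulf_eq0 pnatr_eq0/= => /eqP b0.
by move: bip_gt0; rewrite b0 ltxx.
Qed.

(** Only the first sum of M contributes to the pairing of M u with u, and it is nonnegative; but
    this pairing is [c] times the squared norm of [u], with [c < 0]. *)
Lemma critical_ann_eq0 u : D u = 0 -> (forall x, mu u x = 0) ->
  (forall x, mu x u = 0) -> u = 0.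
Proof.
move=> Du ul ur; apply: (@ip_eq0 _ _ ip); apply/eqP.
rewrite eq_le dnorm_ge0 andbT.
have := ip_Mop2 fr mu mu u u.
rewrite MD add_lfunE scale_lfunE id_lfunE Du addr0 ipZl.
under [X in _ - 2 * X - _]eq_bigr => i _ do rewrite ur ip0l.
under [X in _ - _ - 2 * X]eq_bigr => i _ do rewrite ul ip0l.
rewrite !big1_eq mulr0 !subr0 => h.
have : 0 <= c%:C%C * '[u, u].
  rewrite h mulr_ge0 ?ler0n//.
  by apply: sumr_ge0 => i _; exact: dnorm_ge0.
by rewrite nmulr_rge0// ltcR critical_scalar_lt0.
Qed.

Lemma critical_self_adjoint : self_adjoint ip D.
Proof.
have aD : adj ip D = D.
  have DE : D = Mop2 e mu mu - c%:C%C *: \1%VF by rewrite MD addrAC subrr add0r.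
  rewrite DE (adjD fr) (adjN fr) (adjZ fr) conj_realC (adj_Mop2 fr); congr (_ - _ *: _).
  by apply: adj_uniq => // u v; rewrite !id_lfunE.
by move=> u v; rewrite (adjP fr) aD.
Qed.

End Critical.
End TraceFormula.

(** * The kernel of D *)

(* Here [T] is the multiple of [D] with eigenvalues in [nat]. *)

Section Graded.
Variables (R : realType) (V : vectType R[i]) (ip : {dot V for Num.conj}).
Implicit Types (A B E : 'End(V)) (a b u v w x y z : V).
Local Notation "''[' u , v ]" := (ip u v) : ring_scope.
Variables (I : finType) (e : I -> V).
Hypothesis fr : frame ip e.
Variables (mu : bilin V) (T : 'End(V)).
Hypothesis leib : sym_leibniz mu.
Hypothesis T_der : is_der mu T.
Hypothesis T_self : self_adjoint ip T.
Hypothesis adj_der : forall E, is_der mu E ->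
  (T \o E = E \o T)%VF -> is_der mu (adj ip E).
Hypothesis ann_eq0 : forall u, T u = 0 -> (forall x, mu u x = 0) ->
  (forall x, mu x u = 0) -> u = 0.

Lemma lmult_der x : is_der mu (mu x).
Proof. by case: leib => l _ y z; rewrite l. Qed.

Lemma rmult_der x : is_der mu (rmult mu x).
Proof. by case: leib => _ r y z; rewrite !rmultE r. Qed.

Lemma comm_ker E u : (T \o E = E \o T)%VF -> T u = 0 -> T (E u) = 0.
Proof. by move=> /lfunP/(_ u); rewrite !comp_lfunE => -> ->; rewrite hom0. Qed.

Lemma adj_comm E : (T \o E = E \o T)%VF ->
  (T \o adj ip E = adj ip E \o T)%VF.
Proof.
move=> TE; have TT : adj ip T = T by apply: self_adjoint_adj.
by rewrite -[in LHS]TT -(adj_comp fr) -TE (adj_comp fr) TT.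
Qed.

Lemma lmult_comm u : T u = 0 -> (T \o mu u = mu u \o T)%VF.
Proof.
by move=> Tu; apply/lfunP => x; rewrite !comp_lfunE T_der Tu bilin0l add0r.
Qed.

Lemma rmult_comm u : T u = 0 -> (T \o rmult mu u = rmult mu u \o T)%VF.
Proof.
move=> Tu; apply/lfunP => x.
by rewrite !comp_lfunE !rmultE T_der Tu hom0 addr0.
Qed.

Lemma lmult_adj_der u : T u = 0 -> is_der mu (adj ip (mu u)).
Proof. by move=> Tu; apply: adj_der; [exact: lmult_der|exact: lmult_comm]. Qed.

Lemma rmult_adj_der u : T u = 0 -> is_der mu (adj ip (rmult mu u)).
Proof. by move=> Tu; apply: adj_der; [exact: rmult_der|exact: rmult_comm]. Qed.

Lemma lmult_adj_ker u v : T u = 0 -> T v = 0 -> T (adj ip (mu u) v) = 0.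
Proof. by move=> Tu; apply/comm_ker/adj_comm/lmult_comm. Qed.

Lemma ker_mul u v : T u = 0 -> T v = 0 -> T (mu u v) = 0.
Proof. by move=> Tu Tv; rewrite T_der Tu Tv bilin0l hom0 addr0. Qed.

Definition annihilates u := forall x, mu u x = 0 /\ mu x u = 0.

Lemma der_annihilates E u : is_der mu E -> annihilates u -> annihilates (E u).
Proof.
move=> dE au x; split.
  have := dE u x; rewrite !(au _).1 hom0 addr0 => /esym//.
by have := dE x u; rewrite !(au _).2 hom0 add0r => /esym.
Qed.

(** Adding each Leibniz identity to the one with two arguments exchanged leaves only the product of
    [mu x y + mu y x] with [z]. *)
Lemma symm_annihilates x y : annihilates (mu x y + mu y x).
Proof.
case: leib => l r z; split.
  rewrite bilinDl; apply: (addIr (mu y (mu x z))); rewrite add0r addrAC -l.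
  by rewrite addrC -l.
rewrite homD; apply: (addrI (mu (mu z x) y)); rewrite addr0 addrCA -r addrC.
by rewrite -r.
Qed.

(* The adjoint of left multiplication by [u] preserves the annihilator, on
   which this multiplication vanishes; hence the adjoint vanishes there. *)
Lemma lmult_ortho_ann u y z : T u = 0 -> annihilates z -> '[mu u y, z] = 0.
Proof.
move=> Tu az; have az' := der_annihilates (lmult_adj_der Tu) az.
rewrite (adjP fr) (_ : adj _ _ z = 0) ?ip0r//; apply: (@ip_eq0 _ _ ip).
by rewrite -(adjPr fr) (az' u).2 ip0r.
Qed.

Lemma rmult_ortho_ann u y z : T u = 0 -> annihilates z -> '[mu y u, z] = 0.
Proof.
move=> Tu az; have az' := der_annihilates (rmult_adj_der Tu) az.
rewrite -rmultE (adjP fr) (_ : adj _ _ z = 0) ?ip0r//.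
by apply: (@ip_eq0 _ _ ip); rewrite -(adjPr fr) rmultE (az' u).1 ip0r.
Qed.

(** The symmetrized product annihilates the algebra and is orthogonal to all such elements, hence to
    itself. Since [y] is arbitrary, right multiplication by [u] is minus the left one on all of
    [V]. *)
Lemma ker_anticomm u y : T u = 0 -> mu y u = - mu u y.
Proof.
move=> Tu; apply/eqP; rewrite -addr_eq0; apply/eqP/(@ip_eq0 _ _ ip).
have az := symm_annihilates y u.
by rewrite ipDl (lmult_ortho_ann y Tu az) (rmult_ortho_ann y Tu az) addr0.
Qed.

Lemma ker_alt u : T u = 0 -> mu u u = 0.
Proof.
move=> Tu; have /eqP : (2 : R[i]) *: mu u u = 0.
  by rewrite scaler_nat mulr2n {1}(ker_anticomm _ Tu) addNr.
by rewrite scaler_eq0 pnatr_eq0 => /eqP.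
Qed.

Lemma ker_lie : lie_subalgebra mu (lker T).
Proof.
split=> [x y|x|x y z]; rewrite !memv_ker.
- by move=> /eqP Tx /eqP Ty; rewrite ker_mul.
- by move=> /eqP; exact: ker_alt.
move=> /eqP Tx /eqP Ty /eqP Tz.
rewrite (leib.1 x y z) (ker_anticomm z Tx) homN addrK.
by rewrite (ker_anticomm (mu x y) Tz) addNr.
Qed.

(** One-sided, since [ker_anticomm] yields the products in the other order. *)
Definition ker_central z := T z = 0 /\ forall y, T y = 0 -> mu z y = 0.

Lemma ker_centralP z : ker_central z <-> central mu (lker T) z.
Proof.
split=> [[Tz cz]|[]]; rewrite /central memv_ker.
  split; first exact/eqP.
  by move=> y; rewrite memv_ker => /eqP Ty; rewrite (ker_anticomm _ Tz) cz// oppr0.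
by move=> /eqP Tz cz; split=> // y Ty; apply: (cz y _).1; rewrite memv_ker Ty.
Qed.

Lemma der_ker_central E z : is_der mu E -> (T \o E = E \o T)%VF ->
  ker_central z -> ker_central (E z).
Proof.
move=> dE TE [Tz cz]; split=> [|y Ty]; first exact: comm_ker.
have := dE z y; rewrite (cz y Ty) (cz (E y)) ?comm_ker// hom0 addr0.
exact: esym.
Qed.

(** The adjoint of [mu x] is a derivation commuting with [T], so it keeps [z] in the centre, where
    [mu x] vanishes; hence its value at [z] is orthogonal to itself. *)
Lemma adj_lmult_central x z : T x = 0 -> ker_central z -> adj ip (mu x) z = 0.
Proof.
move=> Tx cz; apply: (@ip_eq0 _ _ ip); rewrite -(adjPr fr).
have [|Tz' cz'] := der_ker_central (lmult_adj_der Tx) _ cz.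
  exact/adj_comm/lmult_comm.
by rewrite (ker_anticomm _ Tz') cz'// oppr0 ip0r.
Qed.

Lemma mul_ortho_central x y z : T x = 0 -> ker_central z -> '[mu x y, z] = 0.
Proof. by move=> Tx cz; rewrite (adjP fr) adj_lmult_central// ip0r. Qed.

(** Apply the derivation [adj ip (mu z)] to [mu z x]: the term where it hits [z] vanishes, and what
    remains is normality. *)
Lemma central_normal z : ker_central z ->
  normal_op ip (mu z) /\ normal_op ip (rmult mu z).
Proof.
move=> cz; have Tz := cz.1; have N : normal_op ip (mu z).
  apply/lfunP => x; rewrite !comp_lfunE (lmult_adj_der Tz z x).
  by rewrite (adj_lmult_central Tz cz) bilin0l add0r.
split=> //; rewrite (_ : rmult mu z = - mu z).
  by rewrite /normal_op (adjN fr) !(comp_lfunNl, comp_lfunNr) N.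
by apply/lfunP => x; rewrite rmultE ker_anticomm// opp_lfunE.
Qed.

(* With [N := mu a] and [F] its adjoint, applying [F] twice to [mu a b = 0]
   shows that [mu (F a) (F b)] lies in J; therefore F (N (F b)) lies in J, while
   it is orthogonal to J because N vanishes on J.  Hence F vanishes on J, and so
   does [N] on the kernel of [T], which it maps to J. *)
Lemma abelian_ideal_central (J : {vspace V}) : ideal mu (lker T) J ->
  (forall a b, a \in J -> b \in J -> mu a b = 0) ->
  forall a, a \in J -> ker_central a.
Proof.
case=> /subvP JT idJ abJ a aJ.
have idl x b : T x = 0 -> b \in J -> mu x b \in J.
  by move=> Tx bJ; apply: (idJ x b _ _).1; rewrite // memv_ker Tx.
have idr x b : T x = 0 -> b \in J -> mu b x \in J.
  by move=> Tx bJ; apply: (idJ x b _ _).2; rewrite // memv_ker Tx.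
have TJ x : x \in J -> T x = 0 by move/JT; rewrite memv_ker => /eqP.
have Ta := TJ a aJ.
set F := adj ip (mu a).
have dF : is_der mu F := lmult_adj_der Ta.
have TF x : T x = 0 -> T (F x) = 0 := lmult_adj_ker Ta.
have F0 b : b \in J -> F b = 0.
  move=> bJ; have Tb := TJ b bJ.
  have FaFb : mu (F a) (F b) \in J.
    have := congr1 F (congr1 F (abJ a b aJ bJ)); rewrite !hom0 dF homD !dF.
    rewrite addrA -(addrA (mu (F (F a)) b)) -mulr2n addrAC => /eqP.
    rewrite addrC addr_eq0 -scaler_nat => /eqP h.
    have n2 : (2 : R[i]) != 0 by rewrite pnatr_eq0.
    rewrite -[mu _ _](scalerK n2) memvZ//.
    rewrite h memvN memvD//; first by rewrite idl// !TF.
    by rewrite idr// !TF.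
  have FNF : F (mu a (F b)) \in J by rewrite dF memvD// idr// !TF.
  have p0 : F (mu a (F b)) = 0.
    by apply: (@ip_eq0 _ _ ip); rewrite {1}/F -(adjPr fr) (abJ _ _ aJ FNF) ip0r.
  have q0 : mu a (F b) = 0.
    by apply: (@ip_eq0 _ _ ip); rewrite (adjPr fr) -/F p0 ip0l.
  by apply: (@ip_eq0 _ _ ip); rewrite -(adjP fr) q0 ip0l.
split=> // x Tx; apply: (@ip_eq0 _ _ ip); rewrite (adjP fr) -/F F0 ?ip0r//.
exact: idr.
Qed.

Lemma ker_prod_space_ideal (J : {vspace V}) :
  ideal mu (lker T) J -> ideal mu (lker T) (prod_space mu J J).
Proof.
move=> [/subvP JT idJ]; split.
  apply: prod_space_sub => a b /JT; rewrite !memv_ker => /eqP Ta /JT.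
  by rewrite memv_ker => /eqP Tb; rewrite ker_mul.
move=> x y xT; have Tx : T x = 0 by move: xT; rewrite memv_ker => /eqP.
suff h : mu x y \in prod_space mu J J -> y \in prod_space mu J J ->
    mu x y \in prod_space mu J J /\ mu y x \in prod_space mu J J.
  move=> yJ; apply: h => //; rewrite memv_preim.
  move: yJ; apply: subvP; apply: prod_space_sub => a b aJ bJ.
  rewrite -memv_preim lmult_der memvD// prod_space_mul//.
    by case: (idJ x a).
  by case: (idJ x b).
by move=> xy _; rewrite (ker_anticomm y Tx) memvN xy.
Qed.

(** By induction on the derived length, the products of elements of [J] are central; being also
    orthogonal to the centre, they are zero, and [J] is abelian. *)
Lemma solvable_ideal_central (J : {vspace V}) : ideal mu (lker T) J ->
  solvable mu J -> forall a, a \in J -> ker_central a.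
Proof.
move=> idJ [k]; elim: k J idJ => [|k IHk] J idJ.
  move=> /= -> a; rewrite memv0 => /eqP ->; split; first exact: hom0.
  by move=> y _; rewrite bilin0l.
rewrite iterSr => /(IHk _ (ker_prod_space_ideal idJ)) cJJ.
have [/subvP JT _] := idJ.
apply: abelian_ideal_central => // a b aJ bJ; apply: (@ip_eq0 _ _ ip).
have Ta : T a = 0 by have := JT a aJ; rewrite memv_ker => /eqP.
by apply: mul_ortho_central => //; apply/cJJ/prod_space_mul.
Qed.

(** With [F] the adjoint of [mu y], the hypothesis first gives [F z = 0]; then the squared norm of
    [mu y z] is the pairing of [z] with the product [mu (F y) z]. *)
Lemma ortho_derived_central z : T z = 0 ->
  (forall x y, T x = 0 -> T y = 0 -> '[z, mu x y] = 0) -> ker_central z.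
Proof.
move=> Tz oz; have az y : T y = 0 -> adj ip (mu y) z = 0.
  move=> Ty; apply: (@ip_eq0 _ _ ip); rewrite -(adjPr fr) oz//.
  exact: lmult_adj_ker.
split=> // y Ty; rewrite -[mu z y]opprK -[RHS]oppr0; congr (- _).
rewrite -(ker_anticomm y Tz); apply: (@ip_eq0 _ _ ip).
rewrite (adjP fr) (lmult_adj_der Ty) az// hom0 addr0 oz//.
exact: lmult_adj_ker.
Qed.

(** By [mem_ker_center], this orthogonal complement of the derived algebra is the centre of l_0. *)
Definition ker_center : {vspace V} :=
  (lker T :&: orthov ip (prod_space mu (lker T) (lker T)))%VS.

Lemma mem_ker_center z : z \in ker_center <-> ker_central z.
Proof.
rewrite memv_cap memv_ker; split.
  move=> /andP[/eqP Tz /mem_orthov_ip oz]; apply: ortho_derived_central => // x y Tx Ty.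
  by apply: oz; rewrite prod_space_mul// memv_ker (Tx, Ty).
move=> cz; rewrite cz.1 eqxx/=; apply/mem_orthov_ip => y yD.
suff /mem_orthov_ip h : y \in orthov ip <[z]>.
  by rewrite ipC h ?memv_line ?conjC0.
move: y yD; apply/subvP/prod_space_sub => a b.
rewrite memv_ker => /eqP Ta _; apply/mem_orthov_ip => y /vlineP[k ->].
by rewrite ipZr mul_ortho_central// mulr0.
Qed.

(** Since l_0 is the orthogonal sum of its centre and its derived algebra [S], an ideal of [S] is an
    ideal of l_0. If solvable it is central, and the centre meets [S] only in 0. *)
Lemma ker_reductive : reductive mu (lker T).
Proof.
set S := prod_space mu (lker T) (lker T).
have [mulT _ _] := ker_lie.
have ST : (S <= lker T)%VS by exact: prod_space_sub.
have ZS : (ker_center :&: S)%VS = 0%VS.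
  apply/eqP; rewrite -subv0; apply/subvP => x.
  move=> /memv_capP[/memv_capP[_ /mem_orthov_ip ox] xS].
  by rewrite memv0; apply/eqP/(@ip_eq0 _ _ ip)/ox.
exists ker_center, S; split=> //.
- by move=> z; rewrite mem_ker_center; exact: ker_centralP.
- split=> // x y xT /(subvP ST) yT; split; exact: prod_space_mul.
- move=> J [/subvP JS idJ] solJ.
  have idTJ : ideal mu (lker T) J.
    split; first by apply/subvP => x /JS; exact: (subvP ST).
    move=> x y xT yJ; have [w wS ow] := ortho_decomp ip S x.
    have cxw : ker_central (x - w).
      apply/mem_ker_center; rewrite memv_cap memvB ?(subvP ST w)//=.
      exact/mem_orthov_ip.
    have Ty : T y = 0 by apply/eqP; rewrite -memv_ker (subvP ST)// JS.
    have xy : mu x y \in J.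
      by rewrite -[x](subrK w) bilinDl cxw.2// add0r; case: (idJ w y wS yJ).
    by split=> //; rewrite ker_anticomm ?memvN//; apply/eqP; rewrite -memv_ker.
  apply/eqP; rewrite -subv0 -ZS; apply/subvP => x xJ.
  rewrite memv_cap JS// andbT; apply/mem_ker_center.
  exact: solvable_ideal_central solJ _ xJ.
- apply: subv_anti; apply/andP; split; first by rewrite subv_add capvSl.
  apply/subvP => x xT; have [w wS ow] := ortho_decomp ip S x.
  rewrite -[x](subrK w); apply: memv_add => //.
  rewrite memv_cap memvB ?(subvP ST w)//=; exact/mem_orthov_ip.
Qed.

Variable kap : I -> nat.
Hypothesis Te : forall i, T (e i) = (kap i)%:R *: e i.

Lemma eigen_ortho m v i : T v = m%:R *: v -> kap i != m -> '[v, e i] = 0.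
Proof.
move=> Tv; apply: contra_neq_eq => vi.
have /eqP := T_self v (e i); rewrite Tv Te ipZl ipZr rmorph_nat.
by rewrite -subr_eq0 -mulrBl mulf_eq0 (negPf vi) orbF subr_eq0 eqr_nat => /eqP.
Qed.

Lemma eigen_mul i j : T (mu (e i) (e j)) = (kap i + kap j)%:R *: mu (e i) (e j).
Proof. by rewrite T_der !Te bilinZl homZ natrD scalerDl. Qed.

(** * The grading and the nilradical *)

(* Membership in the sum of the eigenspaces of [T] of eigenvalue at least [t] *)
Definition deg_ge t v := forall i, (kap i < t)%N -> '[v, e i] = 0.

Lemma deg_ge_D t u v : deg_ge t u -> deg_ge t v -> deg_ge t (u + v).
Proof. by move=> hu hv i it; rewrite ipDl hu// hv// addr0. Qed.

Lemma deg_ge_eigen t v : T v = t%:R *: v -> deg_ge t v.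
Proof. by move=> Tv i it; rewrite (eigen_ortho Tv)// neq_ltn it. Qed.

Lemma deg_ge_mul s t x y : deg_ge s x -> deg_ge t y -> deg_ge (s + t) (mu x y).
Proof.
move=> hx hy k kst; rewrite (fr x) (fr y) bilin_suml ip_suml big1 // => i _.
rewrite bilinZl ipZl; case: (ltnP (kap i) s) => [/hx ->|si]; first by rewrite mul0r.
rewrite hom_sum ip_suml big1 ?mulr0// => j _.
rewrite homZ ipZl; case: (ltnP (kap j) t) => [/hy ->|tj]; first by rewrite mul0r.
rewrite (eigen_ortho (eigen_mul i j)) ?mulr0// neq_ltn.
by rewrite (leq_trans kst) ?leq_add.
Qed.

(** The orthogonal projection to the kernel of [T]: the eigenvectors [e i] of degree 0 form a frame
    of that kernel. *)
Definition proj0 : 'End(V) :=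
  linfun (fun v => \sum_(i | kap i == 0%N) '[v, e i] *: e i).

Lemma proj0E v : proj0 v = \sum_(i | kap i == 0%N) '[v, e i] *: e i.
Proof.
rewrite linear_lfunE// => a x y; rewrite scaler_sumr -big_split/=.
by apply: eq_bigr => i _; rewrite ipDl ipZl scalerDl scalerA.
Qed.

Lemma ker_proj0 v : T (proj0 v) = 0.
Proof.
rewrite proj0E hom_sum big1// => i /eqP ki.
by rewrite homZ Te ki scale0r scaler0.
Qed.

Lemma proj0_id v : T v = 0 -> proj0 v = v.
Proof.
move=> Tv; rewrite proj0E [RHS]fr big_mkcond; apply: eq_bigr => i _.
by case: ifPn => // ki; rewrite (@eigen_ortho 0) ?scale0r ?Tv.
Qed.

Lemma proj0_eq0 v : deg_ge 1 v -> proj0 v = 0.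
Proof.
by move=> hv; rewrite proj0E big1// => i ki; rewrite hv ?scale0r// ltnS leqn0.
Qed.

Lemma deg_ge_sub_proj0 v : deg_ge 1 (v - proj0 v).
Proof.
move=> k; rewrite ltnS leqn0 => /eqP k0; rewrite proj0E {1}(fr v).
rewrite (bigID (fun i => kap i == 0%N))/= addrAC subrr add0r ip_suml big1// => i ki.
by rewrite ipZl ipC (@eigen_ortho (kap i)) ?conjC0 ?mulr0// ?Te ?k0// eq_sym.
Qed.

(** The positive part is an ideal, and [proj0] amounts to the quotient map by it. *)
Lemma proj0_mul x y : proj0 (mu x y) = mu (proj0 x) (proj0 y).
Proof.
have T0 := ker_mul (ker_proj0 x) (ker_proj0 y).
rewrite -[RHS]proj0_id//; apply/eqP; rewrite -subr_eq0 -homB; apply/eqP/proj0_eq0.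
rewrite -[X in mu X y - _](subrK (proj0 x)) bilinDl -addrA -homB.
apply: deg_ge_D; first exact: (@deg_ge_mul 1 0 _ _ (deg_ge_sub_proj0 x)).
exact: (@deg_ge_mul 0 1 _ _ _ (deg_ge_sub_proj0 y)).
Qed.

Lemma lmult_proj0 y : T y = 0 -> (mu y \o proj0 = proj0 \o mu y)%VF.
Proof.
by move=> Ty; apply/lfunP => v; rewrite !comp_lfunE proj0_mul (proj0_id Ty).
Qed.

Section Nilradical.
Variable N : {vspace V}.
Hypothesis NP : forall v, v \in N <-> deg_ge 1 v.

Lemma deg_ge1_ideal : ideal mu fullv N.
Proof.
split; first exact: subvf.
move=> x y _ /NP hy; split; apply/NP; first exact: (@deg_ge_mul 0 1).
exact: (@deg_ge_mul 1 0).
Qed.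

Lemma deg_ge1_nilpotent : nilpotent mu N.
Proof.
(* A product of [k] elements of [N] has degree at least [k]; one factor more than the largest degree
   leaves only zero. *)
exists (\max_i kap i).+1 => // x nx.
have : deg_ge (\max_i kap i).+1 x.
  by elim: nx => {x} [x /NP//|j k x y _ hx _ hy]; exact: deg_ge_mul.
move=> hx; rewrite (fr x) big1// => i _; rewrite hx ?scale0r// ltnS.
exact: leq_bigmax.
Qed.

(** On a vector of degree [m], the iterates for [a] and for [proj0 a] differ by terms of degree
    above [m]. If the former vanishes, the latter is both of degree [m] and of degree above [m]. *)
Lemma nilpotent_lmult_proj0 a k v m : iter k (mu a) v = 0 ->
  T v = m%:R *: v -> iter k (mu (proj0 a)) v = 0.
Proof.
move=> ak Tv; set f := mu (proj0 a).
have [h Th] : deg_ge m.+1 (iter k (mu a) v - iter k f v) /\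
    T (iter k f v) = m%:R *: iter k f v.
  elim: {ak} k => [|k [h Th]] /=; first by rewrite subrr; split=> // i _; rewrite ip0l.
  split; last by rewrite T_der ker_proj0 bilin0l add0r Th homZ.
  rewrite -[X in mu X _ - _](subrK (proj0 a)) bilinDl -addrA -homB.
  apply: deg_ge_D; last exact: (@deg_ge_mul 0 m.+1).
  apply: (@deg_ge_mul 1 m) (deg_ge_sub_proj0 a) _.
  rewrite -[iter k (mu a) v](subrK (iter k f v)); apply: deg_ge_D.
    by move=> i im; apply/h/ltnW.
  exact: deg_ge_eigen.
rewrite ak sub0r in h; rewrite (fr (iter k f v)) big1// => i _.
have [im|im] := eqVneq (kap i) m; last by rewrite (eigen_ortho Th)// scale0r.
by rewrite -[iter k f v]opprK ipNl h ?oppr0 ?scale0r// im.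
Qed.

(** The image of [J] in l_0 is a nilpotent, hence solvable, hence central ideal. Left multiplication
    by [proj0 a] is then normal, and nilpotent on eigenvectors, so it vanishes; thus [proj0 a]
    annihilates the algebra and [ann_eq0] applies. *)
Lemma nilpotent_ideal_sub (J : {vspace V}) :
  ideal mu fullv J -> nilpotent mu J -> (J <= N)%VS.
Proof.
move=> idJ nilJ; apply/subvP => a aJ; apply/NP.
suff a0 : proj0 a = 0 by rewrite -[a]subr0 -a0; exact: deg_ge_sub_proj0.
pose J0 := (proj0 @: J)%VS.
have idJ0 : ideal mu (lker T) J0.
  split; first by apply/subvP => _ /memv_imgP[x _ ->]; rewrite memv_ker ker_proj0.
  move=> x _ + /memv_imgP[y yJ ->]; rewrite memv_ker => /eqP Tx.
  rewrite -[x](proj0_id Tx) -!proj0_mul.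
  by have [] := idJ.2 x y (memvf _) yJ; split; exact: memv_img.
have nilJ0 : nilpotent mu J0.
  have [k k0 nil0] := nilJ; exists k => // x nx.
  have [y ny ->] : exists2 y, nprod mu J k y & x = proj0 y.
    elim: nx => {x k k0 nil0} [x /memv_imgP[y yJ ->]|].
      by exists y => //; exact: nprod1.
    move=> j k x y _ [x' nx' ->] _ [y' ny' ->].
    by exists (mu x' y'); rewrite ?proj0_mul//; exact: nprodM.
  by rewrite (nil0 y ny) hom0.
have mulJ0 x y : x \in J0 -> y \in J0 -> mu x y \in J0.
  by move=> xJ yJ; case: (idJ0.2 x y _ yJ) => //; exact: (subvP idJ0.1).
have c0 : ker_central (proj0 a).
  apply: (solvable_ideal_central idJ0 (nilpotent_solvable mulJ0 nilJ0)).
  exact: memv_img.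
have [nL _] := central_normal c0.
have L0 : mu (proj0 a) = 0.
  apply: (frame_hom_eq fr) => i; rewrite zero_lfunE.
  have [[//|k] k0 nil0] := nilJ.
  apply: (normal_iter_eq0 fr nL (k := k)).
  apply: nilpotent_lmult_proj0 (Te i); apply: nil0; exact: nprod_iter.
apply: ann_eq0 => [|x|x]; first exact: ker_proj0.
  by rewrite L0 zero_lfunE.
by rewrite ker_anticomm ?ker_proj0// L0 zero_lfunE oppr0.
Qed.

Lemma deg_ge1_nilradical : nilradical mu N.
Proof.
split=> [|N' [idN' nilN' maxN']].
  split; [exact: deg_ge1_ideal|exact: deg_ge1_nilpotent|].
  move=> J idJ nilJ NJ; apply: subv_anti; rewrite NJ andbT.
  exact: nilpotent_ideal_sub.
apply/esym/maxN'; [exact: deg_ge1_ideal|exact: deg_ge1_nilpotent|].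
exact: nilpotent_ideal_sub.
Qed.

End Nilradical.

(** This is the unimodularity of l_0: left multiplication by [mu y z] is a commutator, and [mu y]
    commutes with [proj0], so the trace over the kernel vanishes. *)
Lemma trace_ker_comm y z : T y = 0 -> T z = 0 ->
  \sum_(i | kap i == 0%N) '[mu (mu y z) (e i), e i] = 0.
Proof.
move=> Ty Tz.
transitivity (op_trace (mu (mu y z) \o proj0)%VF).
  rewrite (op_trace_frame fr) big_mkcond; apply: eq_bigr => i _.
  rewrite comp_lfunE; case: ifPn => [/eqP ki|ki].
    by rewrite proj0_id// Te ki scale0r.
  rewrite proj0_eq0 ?hom0 ?ip0l// => j j1.
  by apply: (deg_ge_eigen (Te i)); rewrite (leq_trans j1)// lt0n.
have -> : mu (mu y z) = ((mu y \o mu z) - (mu z \o mu y))%VF.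
  apply/lfunP => x; rewrite add_lfunE opp_lfunE !comp_lfunE.
  by rewrite (leib.1 y z x) addrK.
rewrite comp_lfunDl comp_lfunNl op_traceD op_traceN.
by rewrite -!comp_lfunA op_traceM -comp_lfunA -(lmult_proj0 Ty) subrr.
Qed.

(** Unimodularity shows that [w] is orthogonal to the derived algebra, hence central; its own
    adjoint action on l_0 is then zero, and so is the trace that expresses the pairing of [w] with
    itself. *)
Lemma sum_adj_lmult_eq0 :
  \sum_(i | kap i == 0%N) adj ip (mu (e i)) (e i) = 0.
Proof.
set w := \sum_(i | _) _.
have Tei i : kap i == 0%N -> T (e i) = 0 by move=> /eqP ki; rewrite Te ki scale0r.
have Tw : T w = 0.
  by rewrite hom_sum big1// => i ki; rewrite lmult_adj_ker// Tei.
have ipw u : T u = 0 -> '[w, u] = - \sum_(i | kap i == 0%N) '[e i, mu u (e i)].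
  move=> Tu; rewrite ip_suml -sumrN; apply: eq_bigr => i ki.
  by rewrite -(adjPr fr) (ker_anticomm _ Tu) ipNr.
have cw : ker_central w.
  apply: ortho_derived_central => // y z Ty Tz; rewrite ipw ?ker_mul//.
  apply/eqP; rewrite oppr_eq0 -conjC_eq0 rmorph_sum/=; apply/eqP.
  rewrite -[RHS](trace_ker_comm Ty Tz).
  by apply: eq_bigr => i _; rewrite -ipC.
apply: (@ip_eq0 _ _ ip); rewrite ipw// big1 ?oppr0// => i ki.
by rewrite cw.2 ?ip0r// Tei.
Qed.

Lemma sum_comm_adj_eq0 :
  \sum_(i | kap i == 0%N)
    ((mu (e i) \o adj ip (mu (e i))) - (adj ip (mu (e i)) \o mu (e i)))%VF = 0.
Proof.
transitivity (- mu (\sum_(i | kap i == 0%N) adj ip (mu (e i)) (e i))).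
  rewrite hom_sum -sumrN; apply: eq_bigr => i ki; apply/lfunP => x.
  have Tei : T (e i) = 0 by rewrite Te (eqP ki) scale0r.
  rewrite add_lfunE !opp_lfunE !comp_lfunE (lmult_adj_der Tei).
  by rewrite opprD addrCA subrr addr0.
by rewrite sum_adj_lmult_eq0 hom0 oppr0.
Qed.

Lemma ker_ortho_deg_ge1 u v : deg_ge 1 u -> T v = 0 -> '[u, v] = 0.
Proof.
move=> hu Tv; rewrite (parseval fr) big1// => i _.
have [ki|ki] := eqVneq (kap i) 0%N; first by rewrite hu ?ki// mul0r.
by rewrite [X in _ * X]ipC (@eigen_ortho 0 v) ?conjC0 ?mulr0 ?scale0r.
Qed.

(** * Restriction to the positive part *)

Section Restriction.
Variables (W : vectType R[i]) (ipW : {dot W for Num.conj}) (phi : 'Hom(W, V)).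
Hypothesis phi_iso : forall p q, '[phi p, phi q] = ipW p q.
Hypothesis phi_img : forall v, v \in limg phi <-> deg_ge 1 v.
Let nu := pullback phi mu.

Lemma isometry_lker0 : lker phi == 0%VS.
Proof.
rewrite -subv0; apply/subvP => p; rewrite memv_ker memv0 => /eqP p0.
by apply/eqP/(@ip_eq0 _ _ ipW); rewrite -phi_iso p0 ip0l.
Qed.

Lemma isometry_inj : injective phi.
Proof. exact/lker0P/isometry_lker0. Qed.

Lemma img_deg_ge1 p : deg_ge 1 (phi p).
Proof. by apply/phi_img/memv_img/memvf. Qed.

Lemma img_invK v : deg_ge 1 v -> phi ((phi^-1)%VF v) = v.
Proof. by move=> /phi_img vphi; rewrite limg_lfunVK. Qed.

Lemma pullbackE p q : phi (nu p q) = mu (phi p) (phi q).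
Proof.
rewrite linear_lfunE ?comp_lfunE ?img_invK//.
  exact: (@deg_ge_mul 0 1 _ _ _ (img_deg_ge1 q)).
move=> a x y; apply/lfunP => z.
rewrite !(add_lfunE, scale_lfunE, comp_lfunE) (homD phi) (homZ phi).
by rewrite bilinDl bilinZl homD homZ.
Qed.

Lemma pullback_leibniz : sym_leibniz nu.
Proof.
by split=> x y z; apply: isometry_inj; rewrite homD !pullbackE;
  [exact: leib.1|exact: leib.2].
Qed.

Lemma pullback_der (E : 'End(V)) : is_der mu E ->
  (forall p, deg_ge 1 (E (phi p))) ->
  is_der nu (phi^-1 \o E \o phi)%VF.
Proof.
move=> dE hE p q; apply: isometry_inj.
by rewrite homD !pullbackE !comp_lfunE !img_invK// pullbackE dE.
Qed.

(** Projecting the frame to the positive part replaces the vectors of degree 0 by zero and keeps the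
    index type. *)
Let b i := if kap i == 0%N then 0 else e i.
Definition restr_frame i := (phi^-1)%VF (b i).
Local Notation f := restr_frame.

Lemma restr_frameE i : phi (f i) = b i.
Proof.
apply: img_invK => j; rewrite ltnS leqn0 /b => kj.
case: ifPn => [_|ki]; first exact: ip0l.
by apply: (eigen_ortho (Te i)); rewrite (eqP kj) eq_sym.
Qed.

Lemma restr_frameP : frame ipW f.
Proof.
move=> p; apply: isometry_inj; rewrite hom_sum [LHS]fr; apply: eq_bigr => i _.
rewrite homZ -phi_iso restr_frameE /b; case: ifPn => // /eqP ki.
by rewrite img_deg_ge1 ?ki// scale0r scaler0.
Qed.

(* Splitting the sums defining M into the degree 0 part and the rest, the
   difference of both sides is a multiple of the sum in [sum_comm_adj_eq0]. *)
Lemma restr_Mop2 p q :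
  '[Mop2 ip e mu mu (phi p), phi q] = ipW (Mop2 ipW f nu nu p) q.
Proof.
rewrite (ip_Mop2 fr) (ip_Mop2 restr_frameP).
set u := phi p; set v := phi q.
pose G i j := '[u, mu (e i) (e j)] * '[mu (e i) (e j), v].
pose A i := '[adj ip (mu (e i)) u, adj ip (mu (e i)) v].
pose B i := '[mu (e i) u, mu (e i) v].
have T0 i : kap i == 0%N -> T (e i) = 0 by move=> /eqP ki; rewrite Te ki scale0r.
have AG i : A i = \sum_j G i j.
  rewrite /A (parseval fr); apply: eq_bigr => j _.
  by rewrite -(adjPr fr) -(adjP fr).
have A'G i : ipW (adj ipW (nu (f i)) p) (adj ipW (nu (f i)) q) =
    if kap i == 0%N then 0 else \sum_(j | kap j != 0%N) G i j.
  rewrite (parseval restr_frameP) [in RHS]big_mkcond.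
  rewrite [LHS](_ : _ = \sum_j '[u, mu (b i) (b j)] * '[mu (b i) (b j), v]).
    case: ifPn => ki; rewrite /b.
      by apply: big1 => j _; rewrite ki bilin0l ip0r mul0r.
    apply: eq_bigr => j _; rewrite (negPf ki); case: eqP => //=.
    by rewrite hom0 ip0r mul0r.
  apply: eq_bigr => j _.
  rewrite -(adjPr restr_frameP) -(adjP restr_frameP) -!phi_iso !pullbackE.
  by rewrite !restr_frameE.
have -> : \sum_i ipW (nu (f i) p) (nu (f i) q) = \sum_(i | kap i != 0%N) B i.
  rewrite [RHS]big_mkcond; apply: eq_bigr => i _.
  rewrite -phi_iso !pullbackE restr_frameE /b.
  by case: eqP => //=; rewrite bilin0l ip0l.
have -> : \sum_i ipW (nu p (f i)) (nu q (f i)) =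
    \sum_(i | kap i != 0%N) '[mu u (e i), mu v (e i)].
  rewrite [RHS]big_mkcond; apply: eq_bigr => i _.
  rewrite -phi_iso !pullbackE restr_frameE /b.
  by case: eqP => //=; rewrite hom0 ip0l.
under [X in _ = 2 * X - _ - _]eq_bigr => i _ do rewrite A'G.
have -> : \sum_i (if kap i == 0%N then 0 else \sum_(j | kap j != 0%N) G i j) =
    \sum_(i | kap i != 0%N) \sum_(j | kap j != 0%N) G i j.
  by rewrite [RHS]big_mkcond; apply: eq_bigr => i _; case: eqP.
have G00 i j : kap i == 0%N -> kap j == 0%N -> G i j = 0.
  move=> ki kj; rewrite /G ker_ortho_deg_ge1 ?mul0r//; first exact: img_deg_ge1.
  by rewrite ker_mul// T0.
have GC i j : kap j == 0%N -> G i j = G j i.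
  move=> kj; rewrite /G (ker_anticomm _ (T0 _ kj)).
  by rewrite ipNr ipNl mulrNN.
(* Of the four blocks of [G], the one of degrees 0 and 0 vanishes; the two mixed blocks are equal,
   each being the sum of [A] over degree 0. *)
have AE : \sum_i A i = 2 * (\sum_(i | kap i == 0%N) A i) +
    \sum_(i | kap i != 0%N) \sum_(j | kap j != 0%N) G i j.
  rewrite (bigID (fun i => kap i == 0%N))/= mulr_natl mulr2n -addrA; congr (_ + _).
  under eq_bigr => i _ do rewrite AG (bigID (fun j => kap j == 0%N))/=.
  rewrite big_split/=; congr (_ + _).
  rewrite exchange_big/=; apply: eq_bigr => j kj.
  rewrite AG [RHS](bigID (fun i => kap i == 0%N))/= [X in X + _]big1 ?add0r.
    by apply: eq_bigr => i _; rewrite GC.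
  by move=> i ki; rewrite G00.
(* This is the vanishing of the sum of the commutators of [mu (e i)] with their adjoints, paired
   with [u] and [v]. *)
have AB : \sum_(i | kap i == 0%N) A i = \sum_(i | kap i == 0%N) B i.
  apply/eqP; rewrite -subr_eq0 -sumrB.
  transitivity ('[(\sum_(i | kap i == 0%N) ((mu (e i) \o adj ip (mu (e i))) -
      (adj ip (mu (e i)) \o mu (e i)))%VF) u, v] == 0); last first.
    by rewrite sum_comm_adj_eq0 zero_lfunE ip0l eqxx.
  congr (_ == _); rewrite sum_lfunE ip_suml; apply: eq_bigr => i _.
  rewrite add_lfunE opp_lfunE !comp_lfunE ipBl; congr (_ - _).
    by rewrite [RHS](adjP fr).
  by rewrite -[RHS](adjPr fr).
have BE : \sum_i '[mu (e i) u, mu (e i) v] =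
    \sum_(i | kap i == 0%N) B i + \sum_(i | kap i != 0%N) B i.
  by rewrite [LHS](bigID (fun i => kap i == 0%N)).
have CE : \sum_i '[mu u (e i), mu v (e i)] = \sum_(i | kap i == 0%N) B i +
    \sum_(i | kap i != 0%N) '[mu u (e i), mu v (e i)].
  rewrite [LHS](bigID (fun i => kap i == 0%N)); congr (_ + _).
  apply: eq_bigr => i ki.
  by rewrite !(ker_anticomm _ (T0 _ ki)) ipNl ipNr opprK.
rewrite AE BE CE AB; ring.
Qed.

End Restriction.
End Graded.

(** * The moment map and its critical points *)

Section Spectral.
Variables (R : realType) (V : vectType R[i]) (ip : {dot V for Num.conj}).
Local Notation "''[' u , v ]" := (ip u v) : ring_scope.

Lemma self_adjoint_eigenframe (X : seq V) (A : 'End(V)) :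
  orthonormal_basis ip X -> self_adjoint ip A ->
  exists (e : 'I_(size X) -> V) (a : 'I_(size X) -> R),
    frame ip e /\ forall i, A (e i) = (a i)%:C%C *: e i.
Proof.
move=> /onb_frame frx sA; set x := tnth _ in frx.
pose H : 'M[R[i]]_(size X) := \matrix_(i, j) '[A (x i), x j].
have hH : H \is hermsymmx.
  apply/is_hermitianmxP; rewrite expr0 scale1r; apply/matrixP => i j.
  by rewrite !mxE sA [LHS]ipC.
have := orthomx_spectralP (hermitian_normalmx hH).
have := hermitian_spectral_diag_real hH.
set d := spectral_diag H; have := spectral_unitarymx H.
set P := spectralmx H => uP /mxOverP dr HE.
(* As [A (x i)] has the row [i] of [H] as coefficients, the rows of [P] give the eigenvectors. *)
have PH : P *m H = diag_mx d *m P.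
  by rewrite HE !mulmxA mulmxV ?mul1mx// unitarymx_unit.
have PP : map_mx Num.conj P^T *m P = 1%:M.
  by rewrite -invmx_unitary// mulVmx// unitarymx_unit.
pose e i := \sum_j P i j *: x j.
exists e, (fun i => complex.Re (d 0 i)); split=> [v|i]; last first.
  rewrite RRe_real// /e hom_sum scaler_sumr.
  under eq_bigr => j _.
    rewrite homZ (frx (A (x j))) scaler_sumr.
    under eq_bigr => k _ do rewrite scalerA.
    over.
  rewrite exchange_big; apply: eq_bigr => k _ /=; rewrite -scaler_suml scalerA.
  congr (_ *: _); move/matrixP/(_ i k): PH; rewrite mul_diag_mx !mxE => <-.
  by apply: eq_bigr => j _; rewrite !mxE.
(* Orthonormality of the columns of [P] is what makes the new family a frame. *)
have PPE j k : \sum_i Num.conj (P i j) * P i k = (j == k)%:R.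
  move/matrixP/(_ j k): PP; rewrite !mxE => <-.
  by apply: eq_bigr => i _; rewrite !mxE.
transitivity (\sum_j \sum_k ('[v, x j] * (j == k)%:R) *: x k).
  rewrite [LHS]frx; apply: eq_bigr => j _.
  rewrite (bigD1 j)//= eqxx mulr1 big1 ?addr0// => k kj.
  by rewrite eq_sym (negPf kj) mulr0 scale0r.
under eq_bigr => j _ do under eq_bigr => k _ do
  rewrite -PPE mulr_sumr scaler_suml.
under [RHS]eq_bigr => i _.
  rewrite /e ip_sumr scaler_suml.
  under eq_bigr => j _ do rewrite ipZr scaler_sumr.
  over.
rewrite [RHS]exchange_big; apply: eq_bigr => j _ /=.
rewrite exchange_big; apply: eq_bigr => i _ /=; apply: eq_bigr => k _.
by rewrite scalerA mulrA (mulrC '[_, _]).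
Qed.
End Spectral.

Section Moment.
Variables (R : realType) (V : vectType R[i]) (ip : {dot V for Num.conj}).
Implicit Types (A B : 'End(V)) (mu nu : bilin V).
Local Notation "''[' u , v ]" := (ip u v) : ring_scope.

Lemma ReD (z w : R[i]) : complex.Re (z + w) = complex.Re z + complex.Re w.
Proof. by case: z w => [? ?] [? ?]. Qed.

Lemma ReZ (r : R) (z : R[i]) : complex.Re (r%:C%C * z) = r * complex.Re z.
Proof. by case: z => [a b] /=; rewrite mul0r subr0. Qed.

Lemma Re_sum (I : Type) (r : seq I) (P : pred I) (F : I -> R[i]) :
  complex.Re (\sum_(i <- r | P i) F i) = \sum_(i <- r | P i) complex.Re (F i).
Proof. by apply: (big_morph _ ReD). Qed.

(** The terms of [rho] near the identity and [Fn] along a line are quotients of polynomials, so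
    formal derivatives suffice. *)
Lemma is_derive_ratio (P Q : {poly R}) (x : R) : Q.[x] != 0 ->
  is_derive x 1 (fun t => P.[t] / Q.[t])
    ((P^`().[x] * Q.[x] - P.[x] * Q^`().[x]) / Q.[x] ^+ 2).
Proof.
move=> Q0; have dV := is_deriveV Q0 (is_derive_poly Q x).
apply: is_derive_eq (is_deriveM (is_derive_poly P x) dV) _.
by rewrite /GRing.scale/=; field.
Qed.

Lemma one_add_mul_neq0 (t a : R) : `|t| < (1 + `|a|)^-1 -> 1 + t * a != 0.
Proof.
rewrite -[X in _ < X]mul1r ltr_pdivlMr ?ltr_wpDr// => h.
apply/eqP => /eqP; rewrite addrC addr_eq0 => /eqP/(congr1 Num.norm).
rewrite normrM normrN1 => h1; move: h.
by rewrite mulrDr mulr1 h1 gtrDr ltNge normr_ge0.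
Qed.

Lemma dactDr A mu nu : dact A (mu + nu) = dact A mu + dact A nu.
Proof.
apply: bilinP => x y; rewrite bilinED !dactE !bilinED homD.
by rewrite !opprD [RHS]addrACA (addrACA (A _)).
Qed.

Lemma dactZr a A mu : dact A (a *: mu) = a *: dact A mu.
Proof.
by apply: bilinP => x y; rewrite bilinEZ !dactE !bilinEZ homZ !scalerBr.
Qed.

Section Derivative.
Variables (n : nat) (e : 'I_n -> V) (a : 'I_n -> R) (A : 'End(V)).
Hypothesis fr : frame ip e.
Hypothesis Ae : forall i, A (e i) = (a i)%:C%C *: e i.
Hypothesis sA : self_adjoint ip A.

Let g (t : R) : 'End(V) := \1%VF + t%:C%C *: A.

Lemma inv_perturb t : (forall i, 1 + t * a i != 0) ->
  forall i, ((g t)^-1)%VF (e i) = ((1 + t * a i)^-1)%:C%C *: e i.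
Proof.
move=> ta i; have ge j : g t (e j) = (1 + t * a j)%:C%C *: e j.
  rewrite add_lfunE scale_lfunE id_lfunE Ae scalerA rmorphD rmorphM/=.
  by rewrite scalerDl scale1r.
(* Frame vectors may be dependent, so injectivity is read off the pairings with [e j], using that
   [A] is self-adjoint. *)
have k0 : lker (g t) == 0%VS.
  rewrite -subv0; apply/subvP => v; rewrite memv_ker memv0 => /eqP gv.
  rewrite (fr v) big1// => j _.
  have : '[g t v, e j] = (1 + t * a j)%:C%C * '[v, e j].
    rewrite add_lfunE scale_lfunE id_lfunE ipDl ipZl sA Ae ipZr conj_realC.
    by rewrite rmorphD rmorphM/= mulrDl mul1r mulrA.
  rewrite gv ip0l => /esym/eqP; rewrite mulf_eq0.
  rewrite -[X in _ == X]/(0%:C%C) (inj_eq (@complexI _)) (negPf (ta j))/=.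
  by move=> /eqP ->; rewrite scale0r.
rewrite -[RHS](lker0_lfunK k0) homZ ge scalerA -rmorphM/= mulVf//.
by rewrite scale1r.
Qed.

Lemma Re_rho_term t i j mu : (forall i, 1 + t * a i != 0) ->
  let u := mu (e i) (e j) in
  complex.Re '[act (g t) mu (e i) (e j), act (g t) mu (e i) (e j)] =
  (complex.Re '[u, u] + (2 * complex.Re '[A u, u]) * t +
     complex.Re '[A u, A u] * t ^+ 2) / ((1 + t * a i) * (1 + t * a j)) ^+ 2.
Proof.
move=> ta u; rewrite actE !inv_perturb// bilinZl !homZ scalerA -rmorphM/=.
rewrite ipZl ipZr conj_realC mulrA -rmorphM/= ReZ.
rewrite add_lfunE scale_lfunE id_lfunE !(ipDl, ipDr, ipZl, ipZr) conj_realC.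
rewrite -/u !ReD !ReZ (_ : '[u, A u] = '[A u, u]) ?sA//.
by move: (ta i) (ta j) => ? ?; field; apply/andP.
Qed.

(** In an eigenframe of [A] the inverse of 1 + tA is explicit, and [rho] becomes a finite sum of
    rational functions of t. *)
Lemma derive_rho (X : seq V) mu : orthonormal_basis ip X ->
  derive1 (fun t : R => rho ip X mu (\1%VF + t%:C%C *: A)) 0 =
    2 * complex.Re (bip ip e (dact A mu) mu).
Proof.
move=> oX.
pose u i j := mu (e i) (e j).
pose P i j : {poly R} := (complex.Re '[u i j, u i j])%:P +
  (2 * complex.Re '[A (u i j), u i j]) *: 'X +
  (complex.Re '[A (u i j), A (u i j)]) *: 'X^2.
pose Q i j : {poly R} := ((1 + (a i) *: 'X) * (1 + (a j) *: 'X)) ^+ 2.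
pose F (t : R) := \sum_i \sum_j ((P i j).[t] / (Q i j).[t]).
pose dF := \sum_i \sum_j (2 * complex.Re '[A (u i j), u i j] -
   2 * (a i + a j) * complex.Re '[u i j, u i j]).
have der : is_derive (0 : R) 1 F dF.
  have -> : F = \sum_i \sum_j (fun t => (P i j).[t] / (Q i j).[t]).
    apply/funext => t; rewrite fct_sumE; apply: eq_bigr => i _.
    by rewrite fct_sumE.
  apply: is_derive_sum => i; apply: is_derive_sum => j.
  have Q0 : (Q i j).[0] = 1 by rewrite /Q !hornerE; ring.
  apply: is_derive_eq (is_derive_ratio _ _) _; first by rewrite Q0 oner_eq0.
  rewrite Q0 /P /Q expr2 !(derivM, derivD, derivZ, derivC, derivX, derivXn).
  by rewrite !hornerE/=; field.
(* The rational formula is used only near 0, where all the factors [1 + t * a i] are nonzero. *)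
have [_ dE] : is_derive (0 : R) 1
    (fun t : R => rho ip X mu (\1%VF + t%:C%C *: A)) dF.
  apply: near_eq_is_derive der; near=> t.
  have ta i : 1 + t * a i != 0.
    move: i; near: t; apply: filter_forall => /= i.
    have e0 : 0 < (1 + `|a i|)^-1 by rewrite invr_gt0 ltr_wpDr.
    have := @nbhs0_lt _ R^o _ e0; apply: filterS => t.
    exact: one_add_mul_neq0.
  rewrite /F /rho (bilin_ip_frame fr _ _ oX) Re_sum; apply: eq_bigr => i _.
  rewrite Re_sum; apply: eq_bigr => j _; rewrite Re_rho_term//.
  by rewrite /P /Q !hornerE; congr (_ / _); ring.
rewrite derive1E dE /dF Re_sum mulr_sumr; apply: eq_bigr => i _.
rewrite Re_sum mulr_sumr; apply: eq_bigr => j _.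
rewrite dactE !Ae bilinZl homZ !ipBl !ipZl.
rewrite -!mulNr -!rmorphN !ReD !ReZ; ring.
Unshelve. all: by end_near. Qed.

End Derivative.

Section CriticalPoint.
Variable X : seq V.
Hypothesis oX : orthonormal_basis ip X.
Let e := tnth (in_tuple X).
Let fr : frame ip e := onb_frame oX.

Lemma bip_dact_real A mu : self_adjoint ip A ->
  (complex.Re (bip ip e (dact A mu) mu))%:C%C = bip ip e (dact A mu) mu.
Proof.
move=> sA; apply/RRe_real/CrealP.
by rewrite -bipC (bip_dact fr) (self_adjoint_adj fr sA).
Qed.

Lemma bilin_normsqE mu : (bilin_normsq ip X mu)%:C%C = bip ip e mu mu.
Proof.
by rewrite /bilin_normsq (bilin_ip_frame fr)// RRe_real// ger0_real// bip_ge0.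
Qed.

Lemma self_adjoint_Mop2 mu : self_adjoint ip (Mop2 ip e mu mu).
Proof. by move=> u v; rewrite (adjP fr) (adj_Mop2 fr). Qed.

Lemma self_adjointB A B :
  self_adjoint ip A -> self_adjoint ip B -> self_adjoint ip (A - B).
Proof.
by move=> sA sB u v; rewrite !add_lfunE !opp_lfunE ipBl ipBr sA sB.
Qed.

(** The scaled [Mop2] has the defining property by [derive_rho] and [op_trace_Mop2]. Any other
    candidate differs from it by a self-adjoint operator, which is itself a test direction and so
    orthogonal to itself. *)
Lemma momentE mu :
  moment ip X mu = ((bilin_normsq ip X mu)^-1)%:C%C *: Mop2 ip e mu mu.
Proof.
set m0 := _ *: _.
have sm0 : self_adjoint ip m0.
  by move=> u v; rewrite !scale_lfunE ipZl ipZr conj_realC self_adjoint_Mop2.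
have hm0 A : self_adjoint ip A -> op_ip ip m0 A =
    (derive1 (fun t : R => rho ip X mu (\1%VF + t%:C%C *: A)) 0
      / bilin_normsq ip X mu)%:C%C.
  move=> sA; have [e' [a [fr' Ae]]] := self_adjoint_eigenframe oX sA.
  rewrite (derive_rho fr' Ae sA)// -(bip_frame fr _ _ fr').
  rewrite /op_ip (self_adjoint_adj fr sA) -comp_lfunZl op_traceZ (op_trace_Mop2 fr).
  by rewrite !rmorphM/= bip_dact_real// rmorph_nat mulrC.
rewrite /moment; case: xgetP => [m _ [sm hm]|/(_ m0) []//].
apply/eqP; rewrite -subr_eq0; apply/eqP/(op_ip_eq0 fr).
have sB := self_adjointB sm sm0.
rewrite {1}/op_ip comp_lfunDl comp_lfunNl op_traceD op_traceN.
by rewrite -!/(op_ip ip _ _) hm// hm0// subrr.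
Qed.

Lemma FnE mu : Fn ip X mu =
  complex.Re (op_trace (Mop2 ip e mu mu \o Mop2 ip e mu mu)%VF)
    / bilin_normsq ip X mu ^+ 2.
Proof.
rewrite /Fn momentE /op_ip (adjZ fr) (adj_Mop2 fr) conj_realC.
rewrite -comp_lfunZl -comp_lfunZr !op_traceZ !ReZ mulrA -invfM -expr2.
by rewrite mulrC.
Qed.

Lemma Mop2_line mu nu (t : R) :
  Mop2 ip e (mu + t%:C%C *: nu) (mu + t%:C%C *: nu) =
  Mop2 ip e mu mu + t%:C%C *: (Mop2 ip e mu nu + Mop2 ip e nu mu)
    + (t ^+ 2)%:C%C *: Mop2 ip e nu nu.
Proof.
apply: (op_trace_eq fr) => E.
have tE A B C D (a b : R[i]) : op_trace ((A + a *: (B + C) + b *: D) \o E)%VF =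
    op_trace (A \o E)%VF + a * (op_trace (B \o E)%VF + op_trace (C \o E)%VF)
    + b * op_trace (D \o E)%VF.
  by rewrite !comp_lfunDl -!comp_lfunZl !comp_lfunDl !(op_traceD, op_traceZ).
rewrite tE !(op_trace_Mop2 fr).
rewrite !(dactDr, dactZr) !(bipDl, bipDr, bipZl, bipZr) conj_realC rmorphXn/=.
ring.
Qed.

(** Along the line, F is the quotient of [P] by [N ^+ 2]. To first order in t, [P] is - 2 c n - 8 c
    k t and [N] is n + 2 k t, and for these values the derivative of the quotient at 0 cancels. *)
Lemma critical_point_of_decomp mu c D : mu != 0 -> M_decomp ip X mu c D ->
  critical_point ip X mu.
Proof.
move=> mu0; rewrite /M_decomp (Mop_frame _ fr)// => -[MD dD]; split=> // nu.
set M := Mop2 ip e mu mu; set Q := Mop2 ip e mu nu + Mop2 ip e nu mu.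
set M' := Mop2 ip e nu nu.
pose n := bilin_normsq ip X mu.
pose k := complex.Re (bip ip e mu nu).
have nE : n%:C%C = bip ip e mu mu := bilin_normsqE mu.
have n0 : n != 0.
  rewrite -(inj_eq (@complexI R)) nE; apply: contra_neq mu0.
  exact: (bip_eq0 fr).
have kE : 2 * k%:C%C = bip ip e mu nu + bip ip e nu mu.
  by rewrite [bip ip e nu mu]bipC -addcJ.
have NE t : bilin_normsq ip X (mu + t%:C%C *: nu) =
    n + (2 * k) * t + bilin_normsq ip X nu * t ^+ 2.
  apply: (@complexI R); rewrite !(rmorphD, rmorphM, rmorphXn, rmorph_nat)/=.
  rewrite !bilin_normsqE rmorph1.
  rewrite !(bipDl, bipDr, bipZl, bipZr) conj_realC.
  have -> : (1 + 1) * k%:C%C = 2 * k%:C%C by [].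
  rewrite kE; ring.
have T0E : op_trace (M \o M)%VF = (- 2 * c * n)%:C%C.
  by rewrite (op_trace_Mop2_sqr fr MD dD) -nE !rmorphM rmorphN rmorph_nat.
have T1E : op_trace (Q \o M)%VF = (- 4 * c * k)%:C%C.
  rewrite /Q comp_lfunDl op_traceD !(op_trace_Mop2 fr).
  rewrite [X in _ + _ * X](bip_dact fr) (adj_Mop2 fr) [X in _ + _ * X]bipC.
  rewrite !(bip_dact_critical MD dD) rmorphM rmorphN/= conj_realC -bipC.
  rewrite !rmorphM rmorphN rmorph_nat.
  transitivity (- 2 * c%:C%C * (2 * k%:C%C)); first by rewrite kE; ring.
  ring.
pose P : {poly R} := \poly_(i < 5) [:: complex.Re (op_trace (M \o M)%VF);
  complex.Re (op_trace (M \o Q)%VF) + complex.Re (op_trace (Q \o M)%VF);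
  complex.Re (op_trace (M \o M')%VF) + complex.Re (op_trace (Q \o Q)%VF)
    + complex.Re (op_trace (M' \o M)%VF);
  complex.Re (op_trace (M' \o Q)%VF) + complex.Re (op_trace (Q \o M')%VF);
  complex.Re (op_trace (M' \o M')%VF)]`_i.
pose N : {poly R} := \poly_(i < 3) [:: n; 2 * k; bilin_normsq ip X nu]`_i.
have PE t : P.[t] = complex.Re (op_trace
    (Mop2 ip e (mu + t%:C%C *: nu) (mu + t%:C%C *: nu) \o
     Mop2 ip e (mu + t%:C%C *: nu) (mu + t%:C%C *: nu))%VF).
  rewrite Mop2_line -/M -/Q -/M'.
  have tr3 (A B C : 'End(V)) : op_trace ((A + B + C) \o (A + B + C))%VF =
      op_trace (A \o A)%VF + op_trace (A \o B)%VF + op_trace (A \o C)%VF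
    + (op_trace (B \o A)%VF + op_trace (B \o B)%VF + op_trace (B \o C)%VF)
    + (op_trace (C \o A)%VF + op_trace (C \o B)%VF + op_trace (C \o C)%VF).
    by rewrite !comp_lfunDl !comp_lfunDr !op_traceD.
  rewrite tr3 -!comp_lfunZl -!comp_lfunZr !op_traceZ !ReD !ReZ.
  rewrite horner_poly !big_ord_recr big_ord0/=; ring.
have NPE t : N.[t] = bilin_normsq ip X (mu + t%:C%C *: nu).
  by rewrite NE horner_poly !big_ord_recr big_ord0/=; ring.
have N0 : N.[0] = n by rewrite NPE rmorph0 scale0r addr0.
have -> : (fun t : R => Fn ip X (mu + t%:C%C *: nu)) =
    (fun t => P.[t] / (N ^+ 2).[t]).
  by apply/funext => t; rewrite FnE PE horner_exp NPE.
apply: is_derive_eq (is_derive_ratio _ _) _.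
  by rewrite horner_exp N0 expf_neq0.
have coef0 (S : {poly R}) : S^`().[0] = S`_1.
  by rewrite horner_coef0 coef_deriv.
rewrite expr2 derivM !hornerE !coef0 !coef_poly/= N0 horner_coef0 coef_poly/=.
rewrite (op_traceM M Q) T0E T1E /=.
by field; exact: n0.
Qed.

End CriticalPoint.
End Moment.

(** * The structure theorem *)

Section Eigenspaces.
Variables (K : fieldType) (V : vectType K).
Implicit Types (f g : 'End(V)) (v : V) (a k : K).

Lemma mem_leigenspace f a v : (v \in leigenspace f a) = (f v == a *: v).
Proof.
by rewrite memv_ker add_lfunE opp_lfunE scale_lfunE id_lfunE subr_eq0.
Qed.

Lemma leigenspace0 f : leigenspace f 0 = lker f.
Proof. by rewrite /leigenspace scale0r subr0. Qed.

Lemma leigenspace_scale k f g a : k != 0 -> (forall v, g v = k *: f v) ->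
  leigenspace f (a / k) = leigenspace g a.
Proof.
move=> k0 gE; apply/vspaceP => v.
rewrite !mem_leigenspace gE -(inj_eq (scalerI k0)) scalerA.
by rewrite mulrC divfK.
Qed.

Lemma memvZ_neq0 (U : {vspace V}) a v : (a != 0 -> v \in U) -> a *: v \in U.
Proof.
by have [->|a0 /(_ isT)] := eqVneq a 0; [rewrite scale0r mem0v|exact: memvZ].
Qed.

Lemma memv_sum_leigenspace f (s : seq int) (k : int) v :
  k \in s -> f v = k%:~R *: v -> v \in (\sum_(j <- s) leigenspace f j%:~R)%VS.
Proof.
move=> ks fv; rewrite (big_rem _ ks)/=; apply: (subvP (addvSl _ _)).
by rewrite mem_leigenspace fv.
Qed.

Lemma sum_leigenspace_sub f (s : seq int) (U : {vspace V}) :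
  (forall (k : int) v, k \in s -> f v = k%:~R *: v -> v \in U) ->
  (\sum_(j <- s) leigenspace f j%:~R <= U)%VS.
Proof.
move=> h; rewrite big_seq; elim/big_rec: _ => [|k W ks WU]; first exact: sub0v.
rewrite subv_add WU andbT; apply/subvP => v.
by rewrite mem_leigenspace => /eqP; exact: h.
Qed.

Lemma leigenvalueP f a :
  leigenvalue f a <-> exists2 v, v != 0 & f v = a *: v.
Proof.
rewrite /leigenvalue; split=> [h|[v v0 fv]].
  exists (vpick (leigenspace f a)); first by rewrite vpick0.
  by apply/eqP; rewrite -mem_leigenspace memv_pick.
by apply: contra v0 => /eqP h; rewrite -memv0 -h mem_leigenspace fv.
Qed.

End Eigenspaces.

(** * Eigenspaces of a restricted operator *)

Section RestrictedSpectrum.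
Variables (K : fieldType) (V W : vectType K) (phi : 'Hom(W, V)).
Variables (T' : 'End(W)) (T : 'End(V)).
Hypothesis ker_phi : lker phi == 0%VS.
Hypothesis phiT : forall p, phi (T' p) = T (phi p).

Lemma leigenvalue_restr a : leigenvalue T' a <->
  exists v, [/\ v \in limg phi, v != 0 & T v = a *: v].
Proof.
have inj : injective phi by exact/lker0P.
split=> [/leigenvalueP[p p0 Tp]|[_ [/memv_imgP[p _ ->]] v0 Tv]].
  exists (phi p); split; first by rewrite memv_img ?memvf.
    by rewrite -(linear0 phi) (inj_eq inj).
  by rewrite -phiT Tp linearZ.
apply/leigenvalueP; exists p; first by apply: contra v0 => /eqP ->; rewrite linear0.
by apply: inj; rewrite phiT Tv linearZ.
Qed.

Lemma dim_leigenspace_restr a : (forall v, T v = a *: v -> v \in limg phi) ->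
  \dim (leigenspace T' a) = \dim (leigenspace T a).
Proof.
move=> sub_phi; have inj : injective phi by exact/lker0P.
rewrite -(@limg_dim_eq _ _ _ phi); last by rewrite (eqP ker_phi) capv0.
congr (\dim _); apply: subv_anti; apply/andP; split; apply/subvP => v.
  move=> /memv_imgP[p]; rewrite !mem_leigenspace => /eqP Tp ->.
  by rewrite -phiT Tp linearZ.
rewrite mem_leigenspace => /eqP Tv; have /memv_imgP[p _ vE] := sub_phi v Tv.
rewrite vE memv_img// mem_leigenspace; apply/eqP/inj.
by rewrite phiT -vE Tv linearZ vE.
Qed.

End RestrictedSpectrum.

(* Stated for abstract spaces because unification unfolds row vectors. *)
Lemma critical_structure (R : realType) (V : vectType R[i])
    (ip : {dot V for Num.conj}) (X : seq V)
    (mu : bilin V) (c : R) (D : 'End(V)) (s : R)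
    (ks : seq int) (d1 : nat) (ds : seq nat) :
  orthonormal_basis ip X ->
  critical_point_S ip X mu ->
  M_decomp ip X mu c D ->
  0 < s -> int_spectrum (s%:C%C *: D) (0 :: ks) (d1 :: ds) ->
  let l0 := leigenspace D 0 in
  let lp := (\sum_(k <- ks) leigenspace D (k%:~R / s%:C%C))%VS in
  [/\ forall A, A \in l0 ->
        is_der mu (adj ip (mu A)) /\ is_der mu (adj ip (rmult mu A)),
      lie_subalgebra mu l0 /\ reductive mu l0,
      forall Z, central mu l0 Z ->
        normal_op ip (mu Z) /\ normal_op ip (rmult mu Z)
    & nilradical mu lp /\
      forall (W : vectType R[i]) (ipm : {dot W for Num.conj})
          (Y : seq W)
          (phi : 'Hom(W, V)),
        orthonormal_basis ipm Y ->
        limg phi = lp -> isometry ip ipm phi ->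
        let nu := pullback phi mu in
        [/\ sym_leibniz nu, has_type ipm Y nu ks ds
          & nu != 0 -> critical_point_S ipm Y nu]].
Proof.
move=> oX [leib [mu0 _]] [MD dD] s0 [srt gcd1 eigT dsE] l0 lp.
have [T TD] : exists T : 'End(V), T = s%:C%C *: D by exists (s%:C%C *: D).
rewrite -TD in eigT dsE.
have sC0 : s%:C%C != 0 :> R[i] by rewrite gt_eqF// ltcR.
have fr0 := onb_frame oX.
have sD : self_adjoint ip D.
  apply: (critical_self_adjoint fr0 (mu := mu) (c := c)).
  by rewrite -(Mop_frame _ fr0 oX).
have sT : self_adjoint ip T.
  by move=> u v; rewrite TD !scale_lfunE ipZl ipZr conj_realC sD.
have dT : is_der mu T by rewrite TD; exact: is_derZ.
have TE v : T v = s%:C%C *: D v by rewrite TD scale_lfunE.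
have [e [a [fr Ta]]] := self_adjoint_eigenframe oX sT.
have MDe : Mop2 ip e mu mu = c%:C%C *: \1%VF + D by rewrite -(Mop_frame _ fr oX).
have DT0 u : T u = 0 -> D u = 0.
  by rewrite TE => /eqP; rewrite scaler_eq0 (negPf sC0) => /eqP.
have adj_der E : is_der mu E -> (T \o E = E \o T)%VF -> is_der mu (adj ip E).
  move=> dE; rewrite TD -comp_lfunZl -comp_lfunZr => /(scalerI sC0).
  exact: (critical_der_adj fr MDe).
have ann0 u : T u = 0 -> (forall x, mu u x = 0) -> (forall x, mu x u = 0) -> u = 0.
  by move=> /DT0; exact: (critical_ann_eq0 fr MDe).
have ks0 : all (> (0 : int)) ks.
  by apply: (order_path_min _ srt) => x y z; exact: lt_trans.
(* A zero frame vector is given degree 0; any other has its eigenvalue in the nonnegative list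
   [0 :: ks]. *)
have /choice[kap kapP] : forall i, exists k : nat,
    T (e i) = k%:R *: e i /\ (k%:Z \in (0 :: ks)).
  move=> i; have [ei0|ei0] := eqVneq (e i) 0.
    by exists 0%N; rewrite ei0 hom0 scaler0 mem_head.
  have : leigenvalue T (a i)%:C%C by apply/leigenvalueP; exists (e i).
  move=> /eigT/mapP[k kks ak].
  have k0 : 0 <= k.
    by move: kks; rewrite inE => /predU1P[->//|/(allP ks0)/ltW].
  exists `|k|%N; rewrite gez0_abs//; split=> //.
  by rewrite Ta ak -[in LHS](gez0_abs k0).
have Te i : T (e i) = (kap i)%:R *: e i by case: (kapP i).
have l0E : l0 = lker T.
  by rewrite -leigenspace0 -(leigenspace_scale 0 sC0 TE) mul0r.
have lpT : lp = (\sum_(k <- ks) leigenspace T k%:~R)%VS.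
  by apply: eq_bigr => k _; exact: leigenspace_scale.
have eigen_deg (k : int) v : k \in ks -> T v = k%:~R *: v -> deg_ge ip e kap 1 v.
  move=> kks Tv i; rewrite ltnS leqn0 => /eqP ki.
  have := sT v (e i); rewrite Tv Te ki scale0r ip0r ipZl => /eqP.
  rewrite mulf_eq0 intr_eq0 gt_eqF; first by move=> /eqP.
  exact: (allP ks0).
(* Eigenvectors with eigenvalue in [ks] are orthogonal to the kernel; conversely, the frame
   expansion of a vector of degree at least 1 only involves positive eigenvalues. *)
have lpE v : v \in lp <-> deg_ge ip e kap 1 v.
  rewrite lpT; split=> [|hv].
    suff /subvP h : (\sum_(k <- ks) leigenspace T k%:~R <= orthov ip (lker T))%VS.
      move=> /h /mem_orthov_ip o i; rewrite ltnS leqn0 => /eqP ki; apply: o.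
      by rewrite memv_ker Te ki scale0r.
    apply: sum_leigenspace_sub => k u kks Tu; apply/mem_orthov_ip => w.
    rewrite memv_ker => /eqP Tw.
    exact: (ker_ortho_deg_ge1 fr sT Te (eigen_deg k u kks Tu)).
  rewrite (fr v); apply: memv_suml => i _.
  apply: memvZ_neq0 => vi; have ki : kap i != 0%N.
    by apply: contra vi => /eqP ki; rewrite hv ?ki.
  apply: (memv_sum_leigenspace (k := kap i)); last exact: Te.
  by have [_] := kapP i; rewrite inE eqz_nat (negPf ki).
have Tker A : A \in l0 -> T A = 0 by rewrite l0E memv_ker => /eqP.
split.
- move=> A /Tker TA; split; first exact: (lmult_adj_der leib dT adj_der TA).
  exact: (rmult_adj_der leib dT adj_der TA).
- rewrite l0E; split; first exact: (ker_lie fr leib dT adj_der).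
  exact: (ker_reductive fr leib dT sT adj_der).
- move=> Z; rewrite l0E => /(ker_centralP fr leib dT adj_der).
  exact: (central_normal fr leib dT sT adj_der).
split; first exact: (deg_ge1_nilradical fr leib dT sT adj_der ann0 Te).
move=> W ipm Y phi oY phiE iso nu.
have img v : v \in limg phi <-> deg_ge ip e kap 1 v by rewrite phiE.
have frf := restr_frameP fr sT Te iso img.
have nu_leib : sym_leibniz nu by exact: (pullback_leibniz fr leib dT sT Te iso img).
have ker_phi := isometry_lker0 iso.
pose D' : 'End(W) := (phi^-1 \o D \o phi)%VF.
have degD p : deg_ge ip e kap 1 (D (phi p)).
  move=> i; rewrite ltnS leqn0 => /eqP ki; have Tei : T (e i) = 0.
    by rewrite Te ki scale0r.
  by rewrite sD (DT0 _ Tei); exact: ip0r.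
have phiD p : phi (D' p) = D (phi p).
  by rewrite !comp_lfunE (img_invK img (degD p)).
have dD' : is_der nu D' by exact: (pullback_der fr dT sT Te iso img dD degD).
(* By [restr_Mop2], M of the restriction is the compression of M to l_+, so the constant [c] is
   inherited. *)
have MD' : M_decomp ipm Y nu c D'.
  split; last exact: dD'.
  rewrite (Mop_frame nu frf oY).
  apply/lfunP => p; apply: (@ip_injl _ _ ipm) => q.
  rewrite -(restr_Mop2 fr leib dT sT adj_der Te iso img) MDe.
  rewrite !add_lfunE !scale_lfunE !id_lfunE !ipDl !ipZl.
  by rewrite -!iso phiD.
have phiT p : phi ((s%:C%C *: D') p) = T (phi p).
  by rewrite scale_lfunE homZ phiD TE.
have spec : int_spectrum (s%:C%C *: D') ks ds.
  move: (s%:C%C *: D') phiT => T' phiT.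
  split.
  - exact: path_sorted srt.
  (* Removing the eigenvalue 0 does not change the gcd. *)
  - by move: gcd1; rewrite big_cons gcd0n.
  - move=> a0; rewrite (leigenvalue_restr ker_phi phiT); split.
      move=> [v [vphi v0 Tv]].
      have : leigenvalue T a0 by apply/leigenvalueP; exists v.
      move=> /eigT; rewrite /= inE => /predU1P[a00|//].
      (* The eigenvalue 0 is impossible on l_+, since [v] would be orthogonal to itself. *)
      case/negP: v0; apply/eqP/(@ip_eq0 _ _ ip).
      have := ker_ortho_deg_ge1 fr sT Te (u := v) (v := v); apply.
        by apply/img.
      by rewrite Tv a00 mulr0z scale0r.
    move=> /mapP[k kks ->].
    have /leigenvalueP[v v0 Tv] : leigenvalue T k%:~R.
      by apply/eigT/map_f; rewrite inE kks orbT.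
    by exists v; split; [exact/img/(eigen_deg k v kks Tv)|exact: v0|exact: Tv].
  - move: dsE => [_ ->]; apply/eq_in_map => k kks.
    apply/esym/(dim_leigenspace_restr ker_phi phiT) => v Tv.
    exact/img/(eigen_deg k v kks Tv).
split; first exact: nu_leib.
  by exists c, D', s; split; [exact: MD'|exact: s0|exact: spec].
move=> nu0; split; first exact: nu_leib.
exact: (critical_point_of_decomp oY nu0 MD').
Qed.

Theorem theorem4p10 (R : realType) (n : nat)
    (ip : {dot 'rV[R[i]]_n for Num.conj}) (X : seq 'rV[R[i]]_n)
    (mu : bilin 'rV[R[i]]_n) (c : R) (D : 'End('rV[R[i]]_n)) (s : R)
    (ks : seq int) (d1 : nat) (ds : seq nat) :
  orthonormal_basis ip X ->
  critical_point_S ip X mu ->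
  M_decomp ip X mu c D ->
  0 < s -> int_spectrum (s%:C%C *: D) (0 :: ks) (d1 :: ds) ->
  let l0 := leigenspace D 0 in
  let lp := (\sum_(k <- ks) leigenspace D (k%:~R / s%:C%C))%VS in
  [/\ (* (i) *)
      forall A, A \in l0 ->
        is_der mu (adj ip (mu A)) /\ is_der mu (adj ip (rmult mu A)),
      (* (ii) *)
      lie_subalgebra mu l0 /\ reductive mu l0,
      (* (iii) *)
      forall Z, central mu l0 Z ->
        normal_op ip (mu Z) /\ normal_op ip (rmult mu Z)
    & (* (iv) *)
      nilradical mu lp /\
      forall (ipm : {dot 'rV[R[i]]_(\dim lp) for Num.conj})
          (Y : seq 'rV[R[i]]_(\dim lp))
          (phi : 'Hom('rV[R[i]]_(\dim lp), 'rV[R[i]]_n)),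
        orthonormal_basis ipm Y ->
        limg phi = lp -> isometry ip ipm phi ->
        let nu := pullback phi mu in
        [/\ sym_leibniz nu, has_type ipm Y nu ks ds
          & nu != 0 -> critical_point_S ipm Y nu]].
Proof.
move=> oX cX MD s0 spec l0 lp.
have [h1 h2 h3 [h4 h5]] := critical_structure oX cX MD s0 spec.
split; [exact: h1|exact: h2|exact: h3|split; first exact: h4].
by move=> ipm Y phi; exact: h5.
Qed.
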